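(* Let $(\mathcal F_n,\int^{x_n})$ be a Rota-Baxter hierarchy over a field $K$, and let $\mathcal G$ be an admissible coefficient domain for $\mathcal F$. Then the action $\odot:\mathcal G[\int]\times\mathcal F\to\mathcal F$ of the ring of partial integral operators $\mathcal G[\int]$ induced by $g\odot f=gf$ ($g\in\mathcal G$), $M^*\odot f=f[M]$ ($M\in\mathcal M(K)$) and $A_i\odot f=\int^{x_i}f$ ($i\ge1$) is well-defined.
   Context: $K$ is a field of characteristic zero. All $K$-algebras named $\mathcal F,\mathcal G$ are commutative and unital; all bialgebras are commutative and cocommutative. Rota-Baxter operators have weight zero: a linear operator $P$ with $P(u)P(v)=P(uP(v))+P(P(u)v)$. A Rota-Baxter algebra $(G,P)$ over a ring $R\supseteq\mathbb Q$ ($P$ being $R$-linear) is ordinary if $P$ is injective and $G=R\oplus\operatorname{im}P$ as $R$-modules; its associated evaluation is the projector onto $R$ along $\operatorname{im}P$. Matrices. $\mathcal M(K)$ is the monoid of infinite matrices (indexed by $1,2,\dots$) of the form $I+\tilde M$ with $\tilde M$ having finitely many nonzero rows and columns; $M\in\mathcal M_n(K)=K^{n\times n}$ is identified with $\mathrm{diag}(M,I)$. $\tilde{\mathcal M}_m(K)=\{\mathrm{diag}(I_m,M): M\in\mathcal M(K)\}$. $E_n:=I-e_{nn}$; $d_{i,\lambda}:=I+(\lambda-1)e_{ii}$. A scalar $\lambda$ is identified with $\mathrm{diag}(\lambda,1,1,\dots)$; a row $a=(a_1,\dots,a_n)$ is identified with the matrix having first row $a$ and all further rows equal to those of $I$.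 $T_1(e_1):=I+e_{12}$. For $w=(w_{i+1},\dots,w_n)^{\top}\in K^{n-i}$, $L_i(w):=I+\sum_{k>i}w_ke_{ki}$, so $L_i^{-1}(w)=L_i(-w)$; unit vectors $e_k\in K^{n-i}$ are numbered by position. For $w\in K^{n-j}$ and $i<j$, $L_{j-i}(w)$ acting on $K^{n-i}$ denotes the corresponding $(n-i)\times(n-i)$ matrix. For $M\in\mathcal M(K)$, $M_{\lrcorner n}$ has the same first $n$ rows as $M$ and further rows $e_{n+1},e_{n+2},\dots$. $K$-hierarchy. An ascending sequence of $K$-algebras $K=\mathcal F_0\subseteq\mathcal F_1\subseteq\cdots$ with union $\mathcal F$, together with a contravariant monoid action of $\mathcal M(K)$ on $\mathcal F$ by $K$-algebra endomorphisms $M^*$ ($I^*=\mathrm{id}$, $(MN)^*=N^*M^*$) that is straight ($M^*f=M_{\lrcorner n}^*f$ for $f\in\mathcal F_n$) and satisfies $M^*(\mathcal F_n)\subseteq\mathcal F_n$ for $M\in\mathcal M_n(K)$ and $E_n^*(\mathcal F_n)\subseteq\mathcal F_{n-1}$. Rota-Baxter hierarchy. A $K$-hierarchy with commuting Rota-Baxter operators $\int^{x_n}:\mathcal F\to\mathcal F$ ($n\ge1$) such that: (a) for $n\le m$, $\int^{x_n}\mathcal F_m\subseteq\mathcal F_m$ and $\int^{x_n}M^*=M^*\int^{x_n}$ for all $M\in\tilde{\mathcal M}_m(K)$; (b) every $(\mathcal F_n,\int^{x_n})$ is an ordinary Rota-Baxter algebra over $\mathcal F_{n-1}$ with evaluation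 $E_n^*$; (c) $\tau^*\int^{x_i}=\int^{x_j}\tau^*$ for the transposition matrix $\tau=(i\;j)$; (d) for $\lambda\in K\setminus\{0\}$ and $v=(0,v')\in K\oplus K^{n-2}$: $\int^{x_1}\lambda^*=\lambda^{-1}\lambda^*\int^{x_1}$; $\int^{x_1}T_1(e_1)^*=(1-E_1^* )T_1(e_1)^*\int^{x_1}$; and $\int^{x_1}L_1(e_1+v)^*\int^{x_1}=L_2^{-1}(v')^*\,[L_1(e_1)^*,\int^{x_1}]\,\int^{x_2}L_2(v')^*$, where $[S,T]=ST-TS$. A Rota-Baxter subhierarchy consists of subalgebras $\mathcal G_n\subseteq\mathcal F_n$ forming a Rota-Baxter hierarchy under the restricted operators and the restricted matrix action. Scaled Rota-Baxter bialgebra. Let $(B,\Delta,\epsilon)$ be a $K$-bialgebra with product $\nabla$, unit $1$; put $\mathsf e:=1\circ\epsilon$ and $f\oplus g:=\nabla(f\otimes g)\Delta$ for linear endomorphisms. $(B,\Delta,\epsilon,\int)$ is a Rota-Baxter bialgebra if $(B,\int)$ is an ordinary Rota-Baxter algebra over $K$, $\mathsf e$ is the projector onto $K$ along $\operatorname{im}\int$, and $\Delta\int=(\int\otimes\mathrm{id})\Delta+(\mathsf e\otimes\mathrm{id})\Delta\int$. It is scaled if there is also a scaling $\lambda\mapsto\lambda^*$, i.e. a monoid homomorphism from $(K\setminus\{0\},\cdot)$ to bialgebra endomorphisms of $B$ such that, with $0^*:=\mathsf e$, $\lambda\mapsto\lambda^*$ is a semiring homomorphism $(K,+,\cdot)\to(\text{bialgebra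 endomorphisms},\oplus,\circ)$, and $\int\lambda^*=\lambda^{-1}\lambda^*\int$ for $\lambda\ne0$. Its induced Rota-Baxter hierarchy $\mathfrak H(B)$ has components $B_n=B^{\otimes n}$ (embedded in $B_{n+1}$ by $f\mapsto f\otimes1$), operators $\int^{x_n}=\mathrm{id}^{\otimes(n-1)}\otimes\int$, and matrix action $M^*(f_1\otimes\cdots\otimes f_n)=(M_{1\bullet}^*f_1)\cdots(M_{n\bullet}^*f_n)$, where $a^*:=(a_1^*\otimes\cdots\otimes a_n^* )\Delta^n:B\to B_n$ for a row $a$, and $\Delta^n$ is the iterated coproduct. Admissible coefficient domain. A Rota-Baxter hierarchy is separated if it is of the form $\mathfrak H(B)$ for a scaled Rota-Baxter bialgebra $B$. An admissible coefficient domain for $\mathcal F$ is a separated Rota-Baxter subhierarchy $\mathcal G=\mathfrak H(B)\le\mathcal F$; so $\mathcal G_1=B$, $\mathcal G_n=B^{\otimes n}$. Notation. $f[M]:=M^*(f)$; $f[i\;j]:=f[(i\;j)]$ for transpositions (equal to $f$ if $i=j$), and $f[a]$ likewise for a row $a$. For $f\in\mathcal G_1$, $f(x_i):=(1\;i)^*f\in\mathcal G_{(i)}$, where $\mathcal G_{(i)}=(1\;i)^*\mathcal G_1$; $\mathcal G_\alpha$ is the subalgebra generated by the $\mathcal G_{(i)}$, $i\in\alpha$. Tensor expansion: every $g\in\mathcal G_\alpha$ ($\alpha$ finite) is written (via a fixed $K$-basis of $\mathcal G_1$, with scalars absorbed in one component) as $g=\sum_{\mu=1}^r\prod_{j\in\alpha}g\{j\}_\mu$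 with $g\{j\}_\mu\in\mathcal G_{(j)}$; for $\alpha=\{1,\dots,n\}$ put $g\{j\}'_\mu:=\prod_{k\ne j}g\{k\}_\mu$. For a sequence $\gamma$, $\gamma[M]$ is componentwise. Summation over repeated Greek indices is implied. Ring of partial integral operators. For a separated Rota-Baxter hierarchy $\mathcal G$, $\mathcal G[\int]$ is the quotient of the free product (coproduct of unital associative $K$-algebras) of $\mathcal G$, the opposite monoid algebra of $\mathcal M(K)$ (with basis elements $M^*$, so $M^*N^*=(NM)^*$), and the commutative polynomial ring $K[A_1,A_2,\dots]$, by the two-sided ideal generated by the following relations, for all positive integers $i,j$ (with $i<j$ in (3),(4),(7)), all $M\in\mathcal M(K)$ and $g,h\in\mathcal G_1$ (in (1): $g\in\mathcal G$); $n$ is any integer large enough for the matrices involved to lie in $\mathcal M_n(K)$: (1) $M^*g=g[M]M^*$. (2) $M^*A_i=0$ if the $i$-th row of $M$ is zero. (3) $A_j\,g(x_i)=g(x_i)A_j$. (4) $A_i\,g(x_j)=g(x_j)A_i$. (5) If $i:=\min\{k\mid M_{kj}\ne0\}$ exists: $A_j\,g(x_j)M^*=M_{ij}^{-1}\gamma'_\mu(1-E_j^* )\tilde M^*A_i\,\gamma[d_{j,1/M_{ij}}][i\;j]_\mu L_i(l)^*$, where $l=(l_{i+1},\dots,l_n)$, $l_k=M_{kj}/M_{ij}$, $\tilde M=L_i(-l)M$, $\gamma'=\tilde g\{j\}'$, $\gamma=\tilde g\{j\}$, and $\tilde g=g[a]$ for the row $a$ with $a_j=1$, $a_k=-M_{ik}/M_{ij}$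 ($k\ne j$). (6) If the $j$-th column of $M$ is zero: $A_j\,g(x_j)M^*=\big(\int^{x_j}g(x_j)\big)M^*$. (7) For $v\in K^{n-i}$, $w\in K^{n-j}$: $A_jh(x_j)L_j(w)^*A_i\,g(x_i)L_i(v)^*=(1-E_j^* )A_i\,\eta'_\mu L_i(v')^*A_j\,\eta_\mu L_j(w)^*$, where $v'=L_{j-i}^{-1}(w)v$, $\eta'=g(x_i)\tilde h\{i\}$, $\eta=\tilde h\{j\}$, $\tilde h=h[e_j-v_je_i]\in\mathcal G_{(i,j)}$. (8) For $v,w\in K^{n-i}$, $w\ne0$: $A_ih(x_i)L_i(w)^*A_i\,g(x_i)L_i(v)^*=L_k^{-1}(w')^*\chi''[k\;n{+}1]_\mu\big(L_i(\bar w)^*A_i\,g(x_i)\chi'_\mu L_i(v')^*-A_i\,g(x_i)\chi'_\mu L_i(v'+\bar w)^*\big)A_k\,\chi_\mu L_k(w')^*$, where $k=\min\{m>i\mid w_m\ne0\}$, $\bar w=w_ke_{k-i}$, $w'=(w_{k+1},\dots,w_n)^\top/w_k$, $v'=L_{k-i}^{-1}(w')v$, $\tilde h=\frac1{w_k}h[-(v_k/w_k)e_i+e_k/w_k-e_{n+1}/w_k]\in\mathcal G_{(i,k,n+1)}$, $\chi''=\tilde h\{n+1\}$, $\chi'=\tilde h\{i\}$, $\chi=\tilde h\{k\}$. (9) $A_j\,g(x_j)A_j=\big(\int^{x_j}g(x_j)\big)A_j-A_j\big(\int^{x_j}g(x_j)\big)$. That the action is well-defined means that the assignments on generators extend to a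 $K$-algebra homomorphism $\mathcal G[\int]\to\mathrm{End}_K(\mathcal F)$. *)

(* Defs.v *)
(* Conventions.  All indices are shifted by one: rows, columns and variables
   are numbered 0, 1, 2, ..., so that the variable x_{i+1} of the mathematical
   text has index i here, the component F_n involves the variables of index
   < n, E_{i+1} is [imxE i], and the integral along x_{i+1} is [rbint F i].
   F_n, M_n(K), M~_m(K) and the n-th tensor power keep their index. *)
From HB Require Import structures.
From mathcomp Require Import all_boot all_order all_algebra.
From mathcomp Require Import boolp classical_sets fsbigop.

Set Implicit Arguments.
Unset Strict Implicit.
Unset Printing Implicit Defensive.

Import GRing.Theory.
Local Open Scope ring_scope.
Local Open Scope quotient_scope.

Section InfiniteMatrices.
Variable K : fieldType.

Record infmx := InfMx {
  imx_entry :> nat -> nat -> K;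
  imx_fin : exists n, forall r c : nat,
    (n <= r)%N || (n <= c)%N -> imx_entry r c = (r == c)%:R }.

(* M lies in M_n(K), i.e. M = diag(M', I) with M' of size n. *)
Definition in_mx n (M : infmx) : Prop :=
  forall r c : nat, (n <= r)%N || (n <= c)%N -> M r c = (r == c)%:R.

(* M lies in M~_m(K), i.e. M = diag(I_m, M'). *)
Definition in_tmx m (M : infmx) : Prop :=
  forall r c : nat, (r < m)%N || (c < m)%N -> M r c = (r == c)%:R.

Lemma imx_eq (M N : infmx) : (forall r c, M r c = N r c) -> M = N.
Proof.
case: M N => [M hM] [N hN] /= e.
have eMN : M = N by apply/funext => r; apply/funext => c.
by case: N / eMN hN {e} => hN; congr InfMx; apply: Prop_irrelevance.
Qed.

Lemma in_mx_leq m n M : (m <= n)%N -> in_mx m M -> in_mx n M.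
Proof.
move=> mn hM r c /orP[] h; apply: hM; first by rewrite (leq_trans mn h).
by rewrite orbC (leq_trans mn h).
Qed.

Lemma in_mx_ex M : exists n, in_mx n M.
Proof. exact: imx_fin. Qed.

Lemma imx1_fin : exists n, forall r c : nat,
  (n <= r)%N || (n <= c)%N -> ((r == c)%:R : K) = (r == c)%:R.
Proof. by exists 0. Qed.
Definition imx1 := InfMx imx1_fin.

(* All but finitely many terms of the sum vanish, by finiteness of M. *)
Definition imul_entry (M N : infmx) (r c : nat) : K :=
  \sum_(k \in [set: nat]) (M r k * N k c).

Lemma imul_entryE n (M N : infmx) (r c : nat) : in_mx n M -> (r < n)%N ->
  imul_entry M N r c = \sum_(k < n) M r k * N k c.
Proof.
move=> hM rn; rewrite (fsbig_ord _ n (fun k => M r k * N k c)).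
symmetry; apply: fsbig_widen => // k /= [_ /negP]; rewrite -leqNgt => nk.
rewrite hM ?nk ?orbT// (_ : (r == k) = false) ?mul0r//.
by apply/negbTE; rewrite neq_ltn (leq_trans rn nk).
Qed.

Lemma imul_fin (M N : infmx) : exists n, forall r c : nat,
  (n <= r)%N || (n <= c)%N -> imul_entry M N r c = (r == c)%:R.
Proof.
have [[m hm] [n hn]] := (in_mx_ex M, in_mx_ex N).
have hM := in_mx_leq (leq_maxl m n) hm.
have hN := in_mx_leq (leq_maxr m n) hn.
exists (maxn m n) => r c h.
have hM' : in_mx (maxn (maxn m n) r.+1) M := in_mx_leq (leq_maxl _ _) hM.
have rs : (r < maxn (maxn m n) r.+1)%N by rewrite leq_max leqnn orbT.
rewrite (imul_entryE _ _ hM' rs).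
case: (leqP (maxn m n) r) => hr.
  rewrite (bigD1 (Ordinal rs))//= [M r r]hM ?hr// eqxx mul1r.
  rewrite big1 ?addr0 => [|k]; first by rewrite hN ?hr.
  rewrite -val_eqE /= => kr; rewrite hM ?hr// eq_sym (negbTE kr) mul0r//.
have hc : (maxn m n <= c)%N by move: h; rewrite leqNgt hr.
have rc : (r == c) = false.
  by apply/negbTE; rewrite neq_ltn (leq_trans hr hc).
rewrite rc big1// => k _; rewrite [N k c]hN ?hc ?orbT//.
have [kc|] := eqVneq (k : nat) c; last by rewrite mulr0.
by rewrite mulr1 kc hM ?hc ?orbT// rc.
Qed.
Definition imul M N := InfMx (imul_fin M N).

Lemma imulE n (M N : infmx) (r c : nat) : in_mx n M -> (r < n)%N ->
  imul M N r c = \sum_(k < n) M r k * N k c.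
Proof. exact: imul_entryE. Qed.

Lemma imul1m : left_id imx1 imul.
Proof.
move=> M; apply: imx_eq => r c.
have h1 : in_mx r.+1 imx1 by [].
rewrite (imulE _ _ h1)// (bigD1 ord_max)//= eqxx mul1r big1 ?addr0// => k.
by rewrite -val_eqE /= eq_sym => /negbTE ->; rewrite mul0r.
Qed.

Lemma imulm1 : right_id imx1 imul.
Proof.
move=> M; apply: imx_eq => r c; have [n hn] := in_mx_ex M.
pose N := maxn n (maxn r c).+1.
have hM : in_mx N M := in_mx_leq (leq_maxl _ _) hn.
have rN : (r < N)%N by rewrite leq_max ltnS leq_maxl orbT.
have cN : (c < N)%N by rewrite leq_max ltnS leq_maxr orbT.
rewrite (imulE _ _ hM rN) (bigD1 (Ordinal cN))//= eqxx mulr1 big1 ?addr0// => k.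
by rewrite -val_eqE /= => /negbTE ->; rewrite mulr0.
Qed.

Lemma imulA : associative imul.
Proof.
move=> A B C; apply: imx_eq => r c.
have [[[a ha] [b hb]] [d hd]] := (in_mx_ex A, in_mx_ex B, in_mx_ex (imul A B)).
pose N := maxn (maxn a b) (maxn d r.+1).
have hA : in_mx N A by apply: in_mx_leq ha; rewrite !leq_max leqnn.
have hB : in_mx N B by apply: in_mx_leq hb; rewrite !leq_max leqnn orbT.
have hAB : in_mx N (imul A B).
  by apply: in_mx_leq hd; rewrite !leq_max leqnn !orbT.
have rN : (r < N)%N by rewrite !leq_max leqnn !orbT.
rewrite (imulE _ _ hA rN) (imulE _ _ hAB rN).
under eq_bigr => k _ do rewrite (imulE _ _ hB (ltn_ord k)) mulr_sumr.
rewrite exchange_big; apply: eq_bigr => k _.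
rewrite (imulE _ _ hA rN) mulr_suml; apply: eq_bigr => l _.
by rewrite mulrA.
Qed.

HB.instance Definition _ := gen_eqMixin infmx.
HB.instance Definition _ := gen_choiceMixin infmx.
HB.instance Definition _ := isMonoid.Build infmx imulA imul1m imulm1.

(* diag(M, I) *)
Definition imx_of_entry n (M : 'M[K]_n) (r c : nat) : K :=
  match insub r, insub c with
  | Some r', Some c' => M r' c'
  | _, _ => (r == c)%:R
  end.
Lemma imx_of_fin n (M : 'M[K]_n) : exists n, forall r c : nat,
  (n <= r)%N || (n <= c)%N -> imx_of_entry M r c = (r == c)%:R.
Proof.
exists n => r c /orP[] h; rewrite /imx_of_entry.
  by rewrite insubN// -leqNgt.
by case: (insub r) => // r'; rewrite insubN// -leqNgt.
Qed.
Definition imx_of n (M : 'M[K]_n) := InfMx (imx_of_fin M).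

(* The matrix with the same first n rows as M, and further rows as in I. *)
Lemma imx_corner_fin n (M : infmx) : exists m, forall r c : nat,
  (m <= r)%N || (m <= c)%N ->
  (if (r < n)%N then M r c else (r == c)%:R) = (r == c)%:R.
Proof.
by have [m hM] := in_mx_ex M; exists m => r c h; case: ifP => // _; apply: hM.
Qed.
Definition imx_corner n M := InfMx (imx_corner_fin n M).

(* diag(1, ..., 1, a, 1, ...) with a at position i *)
Lemma imx_diag_fin (i : nat) (a : K) : exists n, forall r c : nat,
  (n <= r)%N || (n <= c)%N ->
  (if r == i then a *+ (c == i) else (r == c)%:R) = (r == c)%:R.
Proof.
exists i.+1 => r c; have [->|//] := eqVneq r i.
rewrite ltnn /= => ic; rewrite eq_sym (_ : (i == c) = false)//.
by apply/negbTE; rewrite neq_ltn ic.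
Qed.
Definition imx_diag i a := InfMx (imx_diag_fin i a).

Definition imxE (i : nat) := imx_diag i 0.

(* Row r of the transposition matrix (i j) is the unit row e_{imx_swap i j r}. *)
Definition imx_swap (i j r : nat) : nat :=
  if r == i then j else if r == j then i else r.
Lemma imx_tperm_fin (i j : nat) : exists n, forall r c : nat,
  (n <= r)%N || (n <= c)%N -> ((imx_swap i j r == c)%:R : K) = (r == c)%:R.
Proof.
exists (maxn i j).+1 => r c h; congr (nat_of_bool _)%:R; rewrite /imx_swap.
move: h; rewrite !gtn_max => h.
case: (eqVneq r i) h => [->|_]; last case: (eqVneq r j) => [->|//].
  rewrite ltnn /= => /andP[ic jc].
  by rewrite !eqn_leq ![(c <= _)%N]leqNgt ic jc !andbF.
rewrite ltnn andbF /= => /andP[ic jc].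
by rewrite !eqn_leq ![(c <= _)%N]leqNgt ic jc !andbF.
Qed.
Definition imx_tperm i j := InfMx (imx_tperm_fin i j).

(* I + sum_(k > i) w_k e_{ki}, of size n: only the coordinates k > i of w
   matter, so that w stands for a vector of K^{n-i} whose coordinates are
   numbered by the rows they occupy.  With this numbering, the action on K^{n-i}
   of L_{j-i}(w), for i < j, is the restriction of the action of [Lmx j w]. *)
Definition Lmx n (i : 'I_n) (w : 'cV[K]_n) : 'M[K]_n :=
  \matrix_(r, c) ((r == c)%:R + (w r 0) *+ ((i < r)%N && (c == i))).

(* The first row is a, the others are as in I. *)
Definition rowmx n (a : 'rV[K]_n) : 'M[K]_n :=
  \matrix_(r, c) (if r == 0 :> nat then a 0 c else (r == c)%:R).

(* The unit row e_m. *)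
Definition unit_row n (m : nat) : 'rV[K]_n := \row_(c < n) (c == m :> nat)%:R.

End InfiniteMatrices.

Section TensorPower.
Variables (K : fieldType) (B : comAlgType K) (n : nat).
Implicit Types (f g : {ffun 'I_n -> B}) (i : 'I_n).

Definition upd f i (x : B) : {ffun 'I_n -> B} :=
  [ffun j => if j == i then x else f j].

Definition multilinear (V : lmodType K) (phi : {ffun 'I_n -> B} -> V) : Prop :=
  forall f i a x y,
    phi (upd f i (a *: x + y)) = a *: phi (upd f i x) + phi (upd f i y).

(* Formal K-linear combinations of pure tensors. *)
Definition formal_tensor := seq (K * {ffun 'I_n -> B}).

Definition teval (V : lmodType K) (phi : {ffun 'I_n -> B} -> V)
  (s : formal_tensor) : V := \sum_(p <- s) p.1 *: phi p.2.

(* Two formal combinations denote the same tensor when no multilinear map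
   separates them. *)
Definition tensor_eq : rel formal_tensor := fun s t =>
  `[< forall (V : lmodType K) (phi : {ffun 'I_n -> B} -> V),
        multilinear phi -> teval phi s = teval phi t >].

Lemma tensor_eq_refl : reflexive tensor_eq.
Proof. by move=> s; apply/asboolP. Qed.

Lemma tensor_eq_sym : symmetric tensor_eq.
Proof.
by move=> s t; apply/asboolP/asboolP => h V phi hphi; rewrite (h V phi).
Qed.

Lemma tensor_eq_trans : transitive tensor_eq.
Proof.
move=> t s u /asboolP st /asboolP tu; apply/asboolP => V phi hphi.
by rewrite (st V phi hphi) (tu V phi hphi).
Qed.

Canonical tensor_equiv :=
  EquivRel tensor_eq tensor_eq_refl tensor_eq_sym tensor_eq_trans.

Definition tpow := {eq_quot tensor_equiv}.
HB.instance Definition _ := EqQuotient.on tpow.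
HB.instance Definition _ := Choice.on tpow.

(* The linear map induced by a multilinear one. *)
Definition tlift (V : lmodType K) (phi : {ffun 'I_n -> B} -> V) (t : tpow) : V :=
  teval phi (repr t).

Lemma tlift_pi (V : lmodType K) (phi : {ffun 'I_n -> B} -> V) s :
  multilinear phi -> tlift phi (\pi_tpow s) = teval phi s.
Proof.
move=> hphi; have /eqmodP/asboolP h := reprK (\pi_tpow s).
exact: h.
Qed.

Lemma tensor_ext (x y : tpow) :
  (forall (V : lmodType K) (phi : {ffun 'I_n -> B} -> V),
     multilinear phi -> tlift phi x = tlift phi y) -> x = y.
Proof.
move=> h; rewrite -[x]reprK -[y]reprK; apply/eqmodP/asboolP.
exact: h.
Qed.

Definition tzero : tpow := \pi_tpow [::].
Definition tadd (x y : tpow) : tpow := \pi_tpow (repr x ++ repr y).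
Definition tscale (a : K) (x : tpow) : tpow :=
  \pi_tpow [seq (a * p.1, p.2) | p <- repr x].
Definition topp (x : tpow) : tpow := tscale (-1) x.
Definition tpure f : tpow := \pi_tpow [:: (1, f)].

Section Lift.
Variables (V : lmodType K) (phi : {ffun 'I_n -> B} -> V).
Hypothesis hphi : multilinear phi.

Lemma tlift_zero : tlift phi tzero = 0.
Proof. by rewrite tlift_pi// /teval big_nil. Qed.

Lemma tlift_add x y : tlift phi (tadd x y) = tlift phi x + tlift phi y.
Proof. by rewrite tlift_pi// /teval big_cat. Qed.

Lemma tlift_scale a x : tlift phi (tscale a x) = a *: tlift phi x.
Proof.
rewrite tlift_pi// /teval big_map scaler_sumr.
by apply: eq_bigr => p _; rewrite scalerA.
Qed.

Lemma tlift_opp x : tlift phi (topp x) = - tlift phi x.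
Proof. by rewrite tlift_scale scaleN1r. Qed.

Lemma tlift_pure f : tlift phi (tpure f) = phi f.
Proof. by rewrite tlift_pi// /teval big_seq1 scale1r. Qed.
End Lift.

Let tliftE := (tlift_zero, tlift_add, tlift_scale, tlift_opp, tlift_pure).

Lemma taddA : associative tadd.
Proof.
by move=> x y z; apply: tensor_ext => V phi hphi; rewrite !tliftE// addrA.
Qed.
Lemma taddC : commutative tadd.
Proof.
by move=> x y; apply: tensor_ext => V phi hphi; rewrite !tliftE// addrC.
Qed.
Lemma tadd0 : left_id tzero tadd.
Proof.
by move=> x; apply: tensor_ext => V phi hphi; rewrite !tliftE// add0r.
Qed.
Lemma taddN : left_inverse tzero topp tadd.
Proof.
by move=> x; apply: tensor_ext => V phi hphi; rewrite !tliftE// addNr.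
Qed.
HB.instance Definition _ := GRing.isZmodule.Build tpow taddA taddC tadd0 taddN.

Lemma tscaleA a b x : tscale a (tscale b x) = tscale (a * b) x.
Proof.
by apply: tensor_ext => V phi hphi; rewrite !tliftE// scalerA.
Qed.
Lemma tscale1 : left_id 1 tscale.
Proof.
by move=> x; apply: tensor_ext => V phi hphi; rewrite !tliftE// scale1r.
Qed.
Lemma tscaleDr : right_distributive tscale +%R.
Proof.
by move=> a x y; apply: tensor_ext => V phi hphi; rewrite !tliftE// scalerDr.
Qed.
Lemma tscaleDl x : {morph tscale^~ x : a b / a + b}.
Proof.
by move=> a b; apply: tensor_ext => V phi hphi; rewrite !tliftE// scalerDl.
Qed.
HB.instance Definition _ :=
  GRing.Zmodule_isLmodule.Build K tpow tscaleA tscale1 tscaleDr tscaleDl.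

Lemma tlift_linear (V : lmodType K) (phi : {ffun 'I_n -> B} -> V) :
  multilinear phi -> linear (tlift phi).
Proof. by move=> hphi a x y; rewrite !tliftE. Qed.

Lemma tlift_sum (V : lmodType K) (phi : {ffun 'I_n -> B} -> V) (I : Type)
    (r : seq I) (F : I -> tpow) : multilinear phi ->
  tlift phi (\sum_(i <- r) F i) = \sum_(i <- r) tlift phi (F i).
Proof.
move=> hphi; elim/big_rec2: _ => [|i _ y _ <-]; first exact: tlift_zero.
exact: tlift_add.
Qed.

Lemma tpure_multilinear : multilinear tpure.
Proof.
by move=> f i a x y; apply: tensor_ext => V phi hphi; rewrite !tliftE// hphi.
Qed.

Lemma tpow_sum (t : tpow) : t = \sum_(p <- repr t) p.1 *: tpure p.2.
Proof.
apply: tensor_ext => V phi hphi; rewrite tlift_sum//.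
by rewrite {1}/tlift /teval; apply: eq_bigr => p _; rewrite !tliftE.
Qed.

Lemma tpow_ind (P : tpow -> Prop) : P 0 ->
  (forall a f t, P t -> P (a *: tpure f + t)) -> forall t, P t.
Proof.
move=> P0 PD t; rewrite [t]tpow_sum; elim: (repr t) => [|p s IH].
  by rewrite big_nil.
by rewrite big_cons; apply: PD.
Qed.

Lemma tlift_sumf (V : lmodType K) (I : Type) (r : seq I) (a : I -> K)
    (phi : I -> {ffun 'I_n -> B} -> V) (t : tpow) :
  tlift (fun f => \sum_(i <- r) a i *: phi i f) t
    = \sum_(i <- r) a i *: tlift (phi i) t.
Proof.
rewrite /tlift /teval; under eq_bigr => p _ do rewrite scaler_sumr.
rewrite exchange_big; apply: eq_bigr => i _; rewrite scaler_sumr.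
by apply: eq_bigr => p _; rewrite !scalerA mulrC.
Qed.

Definition fmul f g : {ffun 'I_n -> B} := [ffun j => f j * g j].

Definition tone : tpow := tpure [ffun=> 1].
Definition tmul (x y : tpow) : tpow :=
  tlift (fun f => tlift (fun g => tpure (fmul f g)) y) x.

Lemma fmulC f g : fmul f g = fmul g f.
Proof. by apply/ffunP => j; rewrite !ffunE mulrC. Qed.

Lemma fmul_multilinear (V : lmodType K) (phi : {ffun 'I_n -> B} -> V) f :
  multilinear phi -> multilinear (fun g => phi (fmul f g)).
Proof.
move=> hphi g i a x y /=.
have e z : fmul f (upd g i z) = upd (fmul f g) i (f i * z).
  by apply/ffunP => j; rewrite !ffunE; case: eqP => [->|].
by rewrite !e mulrDr -scalerAr hphi.
Qed.

Let pmul_multilinear f : multilinear (fun g => tpure (fmul f g)).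
Proof. by apply: fmul_multilinear; apply: tpure_multilinear. Qed.

Let mulr_multilinear (y : tpow) :
  multilinear (fun f => tlift (fun g => tpure (fmul f g)) y).
Proof.
move=> f i a u v; rewrite /tlift /teval scaler_sumr -big_split.
apply: eq_bigr => p _ /=; rewrite ![fmul _ p.2]fmulC.
by rewrite pmul_multilinear scalerDr !scalerA mulrC.
Qed.

Lemma tmul_pure f g : tmul (tpure f) (tpure g) = tpure (fmul f g).
Proof. by rewrite /tmul !tlift_pure. Qed.

Lemma tmulPl a x y z : tmul (a *: x + y) z = a *: tmul x z + tmul y z.
Proof. exact: tlift_linear. Qed.

Lemma tmulC : commutative tmul.
Proof.
move=> x y; rewrite /tmul /tlift /teval.
under eq_bigr => p _ do rewrite scaler_sumr.
rewrite exchange_big; apply: eq_bigr => q _; rewrite scaler_sumr.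
by apply: eq_bigr => p _; rewrite !scalerA mulrC fmulC.
Qed.

Lemma tmulPr a x y z : tmul z (a *: x + y) = a *: tmul z x + tmul z y.
Proof. by rewrite ![tmul z _]tmulC tmulPl. Qed.

Lemma tmulDl : left_distributive tmul +%R.
Proof. by move=> x y z; rewrite -[x]scale1r tmulPl !scale1r. Qed.

Lemma tmulDr : right_distributive tmul +%R.
Proof. by move=> x y z; rewrite -[y]scale1r tmulPr !scale1r. Qed.

Let tmul0 z : tmul 0 z = 0.
Proof. exact: tlift_zero. Qed.

Lemma tmul1 : left_id tone tmul.
Proof.
move=> x; elim/tpow_ind: x => [|a f t IH]; first by rewrite tmulC tmul0.
rewrite tmulPr IH tmul_pure; congr (_ *: tpure _ + _).
by apply/ffunP => j; rewrite !ffunE mul1r.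
Qed.

Lemma tmulr1 : right_id tone tmul.
Proof. by move=> x; rewrite tmulC tmul1. Qed.

Lemma tmulA : associative tmul.
Proof.
move=> x y z; elim/tpow_ind: x => [|a f t IH]; first by rewrite !tmul0.
rewrite !tmulPl -IH; congr (_ *: _ + _); clear a t IH.
elim/tpow_ind: y => [|a g t IH].
  by rewrite tmul0 ![tmul (tpure f) _]tmulC !tmul0.
rewrite !tmulPl !tmulPr !tmulPl IH; congr (_ *: _ + _); clear a t IH.
elim/tpow_ind: z => [|b h t IH].
  by rewrite ![tmul _ 0]tmulC ![tmul 0 _]tmul0 tmulC tmul0.
rewrite !tmulPr IH !tmul_pure; congr (_ *: tpure _ + _).
by apply/ffunP => j; rewrite !ffunE mulrA.
Qed.

HB.instance Definition _ := GRing.Zmodule_isPzRing.Build tpow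
  tmulA tmul1 tmulr1 tmulDl tmulDr.
HB.instance Definition _ := GRing.PzRing_hasCommutativeMul.Build tpow tmulC.

Lemma tscaleAl (a : K) (x y : tpow) : a *: (x * y) = (a *: x) * y.
Proof. by rewrite -[a *: x]addr0 [RHS]tmulPl [tmul 0 _]tmul0 addr0. Qed.

(* f_1 (x) ... (x) f_n |-> phi_1(f_1) (x) ... (x) phi_n(f_n) *)
Definition tmap (phi : 'I_n -> B -> B) : tpow -> tpow :=
  tlift (fun f => tpure [ffun i => phi i (f i)]).

End TensorPower.

Section TensorConcat.
Variables (K : fieldType) (B : comAlgType K).

Definition fcons n (x : B) (f : {ffun 'I_n -> B}) : {ffun 'I_n.+1 -> B} :=
  [ffun i => if unlift ord0 i is Some j then f j else x].
Definition frcons n (f : {ffun 'I_n -> B}) (x : B) : {ffun 'I_n.+1 -> B} :=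
  [ffun i => if unlift ord_max i is Some j then f j else x].

(* x (x) t and t (x) x *)
Definition tcons n (x : B) : tpow B n -> tpow B n.+1 :=
  tlift (fun f => tpure (fcons x f)).
Definition trcons n (t : tpow B n) (x : B) : tpow B n.+1 :=
  tlift (fun f => tpure (frcons f x)) t.

Definition tpair (x y : B) : tpow B 2 :=
  tpure [ffun i : 'I_2 => if i == 0 then x else y].

(* The linear map x (x) y |-> phi x y on B (x) B induced by a bilinear phi. *)
Definition tlift2 (V : lmodType K) (phi : B -> B -> V) : tpow B 2 -> V :=
  tlift (fun f : {ffun 'I_2 -> B} => phi (f 0) (f 1)).

End TensorConcat.

(* The copy of K in an algebra *)
Definition scalars (K : fieldType) (A : comAlgType K) : {pred A} :=
  [pred f | `[< exists c : K, f = c%:A >]].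
Arguments scalars {K} A.

Section RotaBaxter.
Variables (K : fieldType) (A : comAlgType K).
(* The base ring R and the algebra G are subalgebras of A; all the conditions
   on P concern its restriction to G. *)
Variables (R G : {pred A}) (P : A -> A).

Record ordinary_rota_baxter : Prop := {
  orb_sub : {subset R <= G};
  orb_stable : {in G, forall u, P u \in G};
  orb_add : {in G &, forall u v, P (u + v) = P u + P v};
  orb_lin : {in R & G, forall c u, P (c * u) = c * P u};
  orb_rb : {in G &, forall u v, P u * P v = P (u * P v) + P (P u * v)};
  orb_inj : {in G &, injective P};
  orb_span : {in G, forall u, exists c v,
    [/\ c \in R, v \in G & u = c + P v]};
  orb_direct : {in G, forall v, P v \in R -> P v = 0} }.

(* E restricts to the projector of G onto R along im P. *)
Definition is_evaluation (E : A -> A) : Prop :=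
  {in R & G, forall c v, E (c + P v) = c}.

End RotaBaxter.

Record hierarchy (K : fieldType) := Hierarchy {
  hcar :> comAlgType K;
  hcomp : nat -> {pred hcar};
  hact : infmx K -> {lrmorphism hcar -> hcar};
  hcomp_subalg : forall n, GRing.subalg_closed (hcomp n);
  hcomp0 : hcomp 0 =i scalars hcar;
  hcompS : forall n, {subset hcomp n <= hcomp n.+1};
  hcomp_union : forall f, exists n, f \in hcomp n;
  hact1 : forall f, hact 1%g f = f;
  hactM : forall M N f, hact (M * N)%g f = hact N (hact M f);
  hact_straight : forall n M,
    {in hcomp n, forall f, hact M f = hact (imx_corner n M) f};
  hact_stable : forall n M, in_mx n M ->
    {in hcomp n, forall f, hact M f \in hcomp n};
  hactE : forall n, {in hcomp n.+1, forall f, hact (imxE K n) f \in hcomp n} }.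
Arguments hcomp {K} _ n : rename.
Arguments hact {K} _ M : rename.

Record rb_hierarchy (K : fieldType) := RBHierarchy {
  rbh :> hierarchy K;
  rbint : nat -> {linear rbh -> rbh};
  rbint_rb : forall i f g,
    rbint i f * rbint i g = rbint i (f * rbint i g) + rbint i (rbint i f * g);
  rbint_comm : forall i j f, rbint i (rbint j f) = rbint j (rbint i f);
  rbint_stable : forall i m, (i < m)%N ->
    {in hcomp rbh m, forall f, rbint i f \in hcomp rbh m};
  rbint_act : forall i m M, (i < m)%N -> in_tmx m M ->
    forall f, rbint i (hact rbh M f) = hact rbh M (rbint i f);
  rbint_ordinary : forall n,
    ordinary_rota_baxter (hcomp rbh n) (hcomp rbh n.+1) (rbint n);
  rbint_eval : forall n,
    is_evaluation (hcomp rbh n) (hcomp rbh n.+1) (rbint n)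
      (hact rbh (imxE K n));
  rbint_tperm : forall i j f,
    hact rbh (imx_tperm K i j) (rbint i f)
      = rbint j (hact rbh (imx_tperm K i j) f);
  rbint_scale : forall a, a != 0 -> forall f,
    rbint 0 (hact rbh (imx_diag 0 a) f)
      = a^-1 *: hact rbh (imx_diag 0 a) (rbint 0 f);
  (* T_1(e_1) = I + e_{12} *)
  rbint_transvection : forall f,
    let T := hact rbh (imx_of (1%:M + delta_mx (0 : 'I_2) 1)) in
    rbint 0 (T f) = T (rbint 0 f) - hact rbh (imxE K 0) (T (rbint 0 f));
  rbint_substitution : forall n (v : 'cV[K]_n.+2), v 1 0 = 0 -> forall f,
    let L i w := hact rbh (imx_of (@Lmx K n.+2 i w)) in
    let e1 := delta_mx 1 0 in
    let f' := rbint 1 (L 1 v f) in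
    rbint 0 (L 0 (e1 + v) (rbint 0 f))
      = L 1 (- v) (L 0 e1 (rbint 0 f') - rbint 0 (L 0 e1 f')) }.

Arguments rbint {K} _ i : rename.

(* The inclusion j exhibits G as a Rota-Baxter subhierarchy of F. *)
Record rb_subhierarchy (K : fieldType) (G F : rb_hierarchy K)
    (j : {lrmorphism G -> F}) : Prop := {
  rbsub_inj : injective j;
  rbsub_comp : forall n, {in hcomp G n, forall g, j g \in hcomp F n};
  rbsub_act : forall M g, j (hact G M g) = hact F M (j g);
  rbsub_int : forall i g, j (rbint G i g) = rbint F i (j g) }.

Record bialgebra (K : fieldType) := Bialgebra {
  bialg :> comAlgType K;
  comul : {linear bialg -> tpow bialg 2};
  counit : {lrmorphism bialg -> K^o};
  comul_monoid : monoid_morphism comul;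
  comul_coassoc : forall f,
    tlift2 (fun x y => trcons (comul x) y) (comul f)
      = tlift2 (fun x y => tcons x (comul y)) (comul f);
  comul_counitl : forall f, tlift2 (fun x y => counit x *: y) (comul f) = f;
  comul_counitr : forall f, tlift2 (fun x y => counit y *: x) (comul f) = f;
  comul_cocomm : forall f, tlift2 (fun x y => tpair y x) (comul f) = comul f }.

Arguments comul {K} _.
Arguments counit {K} _.

Section Bialgebra.
Variables (K : fieldType) (B : bialgebra K).

Definition bconst (f : B) : B := (counit B f : K)%:A.

Definition convolution (phi psi : B -> B) (f : B) : B :=
  tlift2 (fun x y => phi x * psi y) (comul B f).

Record bialgebra_endo (phi : {lrmorphism B -> B}) : Prop := {
  bendo_comul : forall f,
    comul B (phi f) = tmap (fun=> phi) (comul B f);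
  bendo_counit : forall f, counit B (phi f) = counit B f }.

(* The iterated coproduct B -> B^{(x) n}; in particular it is the counit for
   n = 0 and the identity for n = 1. *)
Fixpoint comul_iter (n : nat) : B -> tpow B n :=
  match n return B -> tpow B n with
  | 0 => fun f => (counit B f : K) *: tone B 0
  | n'.+1 => fun f => tlift2 (fun x y => tcons x (comul_iter n' y)) (comul B f)
  end.

End Bialgebra.

Record scaled_rb_bialgebra (K : fieldType) := ScaledRBBialgebra {
  srb :> bialgebra K;
  srb_int : {linear srb -> srb};
  srb_scale : K -> {lrmorphism srb -> srb};
  srb_ordinary : ordinary_rota_baxter (scalars srb) predT srb_int;
  srb_eval : is_evaluation (scalars srb) predT srb_int (@bconst K srb);
  srb_comul_int : forall f,
    comul srb (srb_int f)
      = tlift2 (fun x y => tpair (srb_int x) y) (comul srb f)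
        + tlift2 (fun x y => tpair (bconst x) y) (comul srb (srb_int f));
  srb_scale_endo : forall a, bialgebra_endo (srb_scale a);
  srb_scale0 : forall f, srb_scale 0 f = bconst f;
  srb_scale1 : forall f, srb_scale 1 f = f;
  srb_scaleM : forall a b f, srb_scale (a * b) f = srb_scale a (srb_scale b f);
  srb_scaleD : forall a b f,
    srb_scale (a + b) f = convolution (srb_scale a) (srb_scale b) f;
  srb_int_scale : forall a, a != 0 -> forall f,
    srb_int (srb_scale a f) = a^-1 *: srb_scale a (srb_int f) }.

Arguments srb_int {K} _.
Arguments srb_scale {K} _ a : rename.

Section InducedHierarchy.
Variables (K : fieldType) (B : scaled_rb_bialgebra K).

(* a^* = (a_1^* (x) ... (x) a_n^* ) o Delta^n *)
Definition brow n (a : 'rV[K]_n) (f : B) : tpow B n :=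
  tmap (fun i => srb_scale B (a 0 i)) (comul_iter n f).

(* M^* ( f_1 (x) ... (x) f_n ) = prod_i (row i of M)^* f_i *)
Definition bact n (M : 'M[K]_n) : tpow B n -> tpow B n :=
  tlift (fun f : {ffun 'I_n -> B} => \prod_(i < n) brow (row i M) (f i)).

Definition bint n (i : 'I_n) : tpow B n -> tpow B n :=
  tmap (fun k f => if k == i then srb_int B f else f).

End InducedHierarchy.

(* G is (isomorphic to) the hierarchy induced by some B: the iota_n are
   isomorphisms of the tensor powers of B onto the components of G, compatible
   with the embeddings f |-> f (x) 1, hence with the direct limits.  Any element
   of M(K) and any tensor lie in M_n(K) and the n-th tensor power for a common
   n, so that the condition on M_n(K) determines the whole action. *)
Definition separated (K : fieldType) (G : rb_hierarchy K) : Prop :=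
  exists (B : scaled_rb_bialgebra K) (iota : forall n, {linear tpow B n -> G}),
    [/\ forall n, injective (iota n) /\ monoid_morphism (iota n),
        forall n g, g \in hcomp G n <-> exists t, g = iota n t,
        forall n t, iota n.+1 (trcons t 1) = iota n t,
        forall n (i : 'I_n) t, rbint G i (iota n t) = iota n (bint i t)
      & forall n (M : 'M[K]_n) t, hact G (imx_of M) (iota n t)
                                    = iota n (bact M t)].

Definition admissible_domain (K : fieldType) (G F : rb_hierarchy K)
    (j : {lrmorphism G -> F}) : Prop :=
  rb_subhierarchy j /\ separated G.

Section PresentedAlgebra.
Variables (K : fieldType) (X : Type).

Inductive pterm :=
  | PConst of K
  | PVar of X
  | PAdd of pterm & pterm
  | PMul of pterm & pterm.

HB.instance Definition _ := gen_eqMixin pterm.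
HB.instance Definition _ := gen_choiceMixin pterm.

Variable rel : pterm -> pterm -> Prop.

(* The least congruence that contains the relations and turns the terms into an
   associative unital K-algebra. *)
Inductive pcong : pterm -> pterm -> Prop :=
  | pcong_rel s t : rel s t -> pcong s t
  | pcong_refl t : pcong t t
  | pcong_sym s t : pcong s t -> pcong t s
  | pcong_trans s t u : pcong s t -> pcong t u -> pcong s u
  | pcong_add s s' t t' :
      pcong s s' -> pcong t t' -> pcong (PAdd s t) (PAdd s' t')
  | pcong_mul s s' t t' :
      pcong s s' -> pcong t t' -> pcong (PMul s t) (PMul s' t')
  | pcong_addA s t u : pcong (PAdd s (PAdd t u)) (PAdd (PAdd s t) u)
  | pcong_addC s t : pcong (PAdd s t) (PAdd t s)
  | pcong_add0 t : pcong (PAdd (PConst 0) t) t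
  | pcong_addN t : pcong (PAdd (PMul (PConst (-1)) t) t) (PConst 0)
  | pcong_mulA s t u : pcong (PMul s (PMul t u)) (PMul (PMul s t) u)
  | pcong_mul1l t : pcong (PMul (PConst 1) t) t
  | pcong_mul1r t : pcong (PMul t (PConst 1)) t
  | pcong_mulDl s t u :
      pcong (PMul (PAdd s t) u) (PAdd (PMul s u) (PMul t u))
  | pcong_mulDr s t u :
      pcong (PMul s (PAdd t u)) (PAdd (PMul s t) (PMul s u))
  | pcong_constD a b : pcong (PConst (a + b)) (PAdd (PConst a) (PConst b))
  | pcong_constM a b : pcong (PConst (a * b)) (PMul (PConst a) (PConst b))
  | pcong_constC a t : pcong (PMul (PConst a) t) (PMul t (PConst a)).

Definition pcongb s t := `[< pcong s t >].

Lemma pcongb_refl : reflexive pcongb.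
Proof. by move=> t; apply/asboolP; apply: pcong_refl. Qed.
Lemma pcongb_sym : symmetric pcongb.
Proof. by move=> s t; apply/asboolP/asboolP; apply: pcong_sym. Qed.
Lemma pcongb_trans : transitive pcongb.
Proof.
move=> t s u /asboolP st /asboolP tu; apply/asboolP.
exact: pcong_trans st tu.
Qed.

Canonical pcong_equiv := EquivRel pcongb pcongb_refl pcongb_sym pcongb_trans.

Definition palg := {eq_quot pcong_equiv}.
HB.instance Definition _ := EqQuotient.on palg.
HB.instance Definition _ := Choice.on palg.

Definition pclass (t : pterm) : palg := \pi_palg t.
Definition pgen (x : X) : palg := pclass (PVar x).

Lemma pclassP s t : pclass s = pclass t <-> pcong s t.
Proof. by split=> [/eqmodP/asboolP|h] //; apply/eqmodP/asboolP. Qed.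

Lemma pclass_repr (a : palg) : pclass (repr a) = a.
Proof. exact: reprK. Qed.

Lemma palg_ind (P : palg -> Prop) : (forall t, P (pclass t)) -> forall a, P a.
Proof. by move=> h a; rewrite -[a]pclass_repr. Qed.

Definition padd (a b : palg) := pclass (PAdd (repr a) (repr b)).
Definition pmul (a b : palg) := pclass (PMul (repr a) (repr b)).
Definition popp (a : palg) := pclass (PMul (PConst (-1)) (repr a)).
Definition pscale (c : K) (a : palg) := pclass (PMul (PConst c) (repr a)).

Lemma pcong_repr t : pcong (repr (pclass t)) t.
Proof. by apply/pclassP; rewrite pclass_repr. Qed.

Lemma padd_class s t : padd (pclass s) (pclass t) = pclass (PAdd s t).
Proof. by apply/pclassP; apply: pcong_add; apply: pcong_repr. Qed.
Lemma pmul_class s t : pmul (pclass s) (pclass t) = pclass (PMul s t).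
Proof. by apply/pclassP; apply: pcong_mul; apply: pcong_repr. Qed.
Lemma popp_class t : popp (pclass t) = pclass (PMul (PConst (-1)) t).
Proof.
by apply/pclassP; apply: pcong_mul; [apply: pcong_refl | apply: pcong_repr].
Qed.
Lemma pscale_class c t : pscale c (pclass t) = pclass (PMul (PConst c) t).
Proof.
by apply/pclassP; apply: pcong_mul; [apply: pcong_refl | apply: pcong_repr].
Qed.

Let pclassE := (padd_class, pmul_class, popp_class, pscale_class).

Lemma paddA : associative padd.
Proof.
elim/palg_ind=> s; elim/palg_ind=> t; elim/palg_ind=> u.
by rewrite !pclassE; apply/pclassP/pcong_addA.
Qed.
Lemma paddC : commutative padd.
Proof.
elim/palg_ind=> s; elim/palg_ind=> t.
by rewrite !pclassE; apply/pclassP/pcong_addC.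
Qed.
Lemma padd0 : left_id (pclass (PConst 0)) padd.
Proof.
by elim/palg_ind=> s; rewrite !pclassE; apply/pclassP/pcong_add0.
Qed.
Lemma paddN : left_inverse (pclass (PConst 0)) popp padd.
Proof.
by elim/palg_ind=> s; rewrite !pclassE; apply/pclassP/pcong_addN.
Qed.
Lemma pmulA : associative pmul.
Proof.
elim/palg_ind=> s; elim/palg_ind=> t; elim/palg_ind=> u.
by rewrite !pclassE; apply/pclassP/pcong_mulA.
Qed.
Lemma pmul1l : left_id (pclass (PConst 1)) pmul.
Proof.
by elim/palg_ind=> s; rewrite !pclassE; apply/pclassP/pcong_mul1l.
Qed.
Lemma pmul1r : right_id (pclass (PConst 1)) pmul.
Proof.
by elim/palg_ind=> s; rewrite !pclassE; apply/pclassP/pcong_mul1r.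
Qed.
Lemma pmulDl : left_distributive pmul padd.
Proof.
elim/palg_ind=> s; elim/palg_ind=> t; elim/palg_ind=> u.
by rewrite !pclassE; apply/pclassP/pcong_mulDl.
Qed.
Lemma pmulDr : right_distributive pmul padd.
Proof.
elim/palg_ind=> s; elim/palg_ind=> t; elim/palg_ind=> u.
by rewrite !pclassE; apply/pclassP/pcong_mulDr.
Qed.

HB.instance Definition _ := GRing.isPzRing.Build palg
  paddA paddC padd0 paddN pmulA pmul1l pmul1r pmulDl pmulDr.

Lemma pscaleE c (a : palg) : pscale c a = pclass (PConst c) * a.
Proof. by elim/palg_ind: a => t; rewrite pscale_class [RHS]pmul_class. Qed.

Lemma pscaleA a b (x : palg) : pscale a (pscale b x) = pscale (a * b) x.
Proof.
rewrite !pscaleE mulrA; congr (_ * _).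
by rewrite [LHS]pmul_class; apply/pclassP/pcong_sym/pcong_constM.
Qed.
Lemma pscale1 : left_id 1 pscale.
Proof. by move=> x; rewrite pscaleE; apply: mul1r. Qed.
Lemma pscaleDr : right_distributive pscale +%R.
Proof. by move=> a x y; rewrite !pscaleE mulrDr. Qed.
Lemma pscaleDl x : {morph pscale^~ x : a b / a + b}.
Proof.
move=> a b; rewrite !pscaleE -mulrDl; congr (_ * _).
by rewrite [RHS]padd_class; apply/pclassP/pcong_constD.
Qed.
HB.instance Definition _ := GRing.Zmodule_isLmodule.Build K palg
  pscaleA pscale1 pscaleDr pscaleDl.

Lemma palg_scalerAl (c : K) (x y : palg) : c *: (x * y) = (c *: x) * y.
Proof. by rewrite ![_ *: _]pscaleE mulrA. Qed.
Lemma palg_scalerAr (c : K) (x y : palg) : c *: (x * y) = x * (c *: y).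
Proof.
rewrite ![_ *: _]pscaleE !mulrA; congr (_ * _).
elim/palg_ind: x => t; rewrite [LHS]pmul_class [RHS]pmul_class.
exact/pclassP/pcong_constC.
Qed.

End PresentedAlgebra.

Declare Scope pterm_scope.
Delimit Scope pterm_scope with pterm.
Bind Scope pterm_scope with pterm.
Notation "s + t" := (PAdd s t) : pterm_scope.
Notation "s * t" := (PMul s t) : pterm_scope.
Notation "s - t" := (PAdd s (PMul (PConst _ (-1)) t)) : pterm_scope.
Notation "\sum_ ( i < n ) F" := (\big[@PAdd _ _/PConst _ 0]_(i < n) F%pterm)
  : pterm_scope.

Section PartialIntegralOperators.
Variables (K : fieldType) (G : rb_hierarchy K).

Inductive pio_gen :=
  | GCoef of G
  | GSubst of infmx K
  | GInt of nat.

Local Notation term := (pterm K pio_gen).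
Local Notation cst := (@PConst K pio_gen).
Local Notation co g := (@PVar K pio_gen (GCoef g)).
Local Notation su M := (@PVar K pio_gen (GSubst M)).
Local Notation A i := (@PVar K pio_gen (GInt i)).

(* g(x_i), for g in G_1 *)
Definition at_slot (i : nat) (g : G) : G := hact G (imx_tperm K 0 i) g.

(* G_(i) *)
Definition slot (i : nat) (u : G) : Prop :=
  exists2 g, g \in hcomp G 1 & u = at_slot i g.

(* g = sum_mu prod_(k in alpha) c mu k, with c mu k in G_(k) for k in alpha.
   In the relations below all such expansions of the given element are allowed:
   the expressions built from them are multilinear in the components, and for
   separated G the multiplication maps of the G_(k) are isomorphisms from their
   tensor product, so that the ideal is the one obtained from the expansions
   with respect to any fixed basis. *)
Definition expansion (alpha : seq nat) (g : G) (r : nat)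
    (c : 'I_r -> nat -> G) : Prop :=
  (forall mu k, k \in alpha -> slot k (c mu k)) /\
  g = \sum_(mu < r) \prod_(k <- alpha) c mu k.

Local Notation subst M := (hact G M).
Local Notation subst_row a := (hact G (imx_of (rowmx a))).
Local Notation G1 := (hcomp G 1).
Local Notation Lop i w := (su (imx_of (Lmx i w))).

Inductive pio_rel : term -> term -> Prop :=
  (* The first six relations present the free product of G, of the opposite
     monoid algebra of M(K), and of the polynomial ring in the A_i. *)
  | pio_coefD g h : pio_rel (co (g + h)) (co g + co h)
  | pio_coefM g h : pio_rel (co (g * h)) (co g * co h)
  | pio_coefC c : pio_rel (co c%:A) (cst c)
  | pio_subst1 : pio_rel (su 1%g) (cst 1)
  | pio_substM M N : pio_rel (su M * su N) (su (N * M)%g)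
  | pio_intC i j : pio_rel (A i * A j) (A j * A i)
  | pio_subst_coef M g : pio_rel (su M * co g) (co (subst M g) * su M)
  | pio_subst_int (M : infmx K) i :
      (forall c, M i c = 0) -> pio_rel (su M * A i) (cst 0)
  | pio_int_coef_lt i j g : (i < j)%N -> g \in G1 ->
      pio_rel (A j * co (at_slot i g)) (co (at_slot i g) * A j)
  | pio_int_coef_gt i j g : (i < j)%N -> g \in G1 ->
      pio_rel (A i * co (at_slot j g)) (co (at_slot j g) * A i)
  (* i is the least index with M i j != 0. *)
  | pio_int_subst n (M : 'M[K]_n) (i j : 'I_n) g r gamma :
      g \in G1 ->
      M i j != 0 -> (forall k : 'I_n, (k < i)%N -> M k j = 0) ->
      let l : 'cV_n := \col_k (M k j / M i j) in
      let M' := Lmx i (- l) *m M in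
      let a : 'rV_n := \row_k (if k == j then 1 else - (M i k / M i j)) in
      @expansion (index_iota 0 n) (subst_row a g) r gamma ->
      pio_rel (A j * co (at_slot j g) * su (imx_of M))
        (cst (M i j)^-1 *
         \sum_(mu < r)
           co (\prod_(0 <= k < n | k != j) gamma mu k)
           * (cst 1 - su (imxE K j)) * su (imx_of M') * A i
           * co (subst (imx_tperm K i j)
                   (subst (imx_diag j (M i j)^-1) (gamma mu j)))
           * Lop i l)
  | pio_int_subst0 (M : infmx K) j g :
      g \in G1 -> (forall k, M k j = 0) ->
      pio_rel (A j * co (at_slot j g) * su M)
        (co (rbint G j (at_slot j g)) * su M)
  | pio_int_int_lt n (i j : 'I_n) (v w : 'cV[K]_n) g h r eta :
      (i < j)%N -> g \in G1 -> h \in G1 ->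
      let v' := Lmx j (- w) *m v in
      @expansion [:: i : nat; j : nat]
        (subst_row (unit_row K n j - v j 0 *: unit_row K n i) h) r eta ->
      pio_rel
        (A j * co (at_slot j h) * Lop j w * A i * co (at_slot i g) * Lop i v)
        (\sum_(mu < r)
           (cst 1 - su (imxE K j)) * A i * co (at_slot i g * eta mu i)
           * Lop i v' * A j * co (eta mu j) * Lop j w)
  (* x_n serves as an additional variable: v and w involve only indices < n. *)
  | pio_int_int_eq n (i k : 'I_n) (v w : 'cV[K]_n) g h r chi :
      g \in G1 -> h \in G1 ->
      (i < k)%N -> w k 0 != 0 ->
      (forall m : 'I_n, (i < m < k)%N -> w m 0 = 0) ->
      let wbar := w k 0 *: delta_mx k 0 in
      let w' := (w k 0)^-1 *: w in
      let v' := Lmx k (- w') *m v in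
      let a := - (v k 0 / w k 0) *: unit_row K n.+1 i
               + (w k 0)^-1 *: unit_row K n.+1 k
               - (w k 0)^-1 *: unit_row K n.+1 n in
      @expansion [:: i : nat; k : nat; n]
        ((w k 0)^-1 *: subst_row a h) r chi ->
      pio_rel
        (A i * co (at_slot i h) * Lop i w * A i * co (at_slot i g) * Lop i v)
        (\sum_(mu < r)
           Lop k (- w') * co (subst (imx_tperm K k n) (chi mu n))
           * (Lop i wbar * A i * co (at_slot i g * chi mu i) * Lop i v'
              - A i * co (at_slot i g * chi mu i) * Lop i (v' + wbar))
           * A k * co (chi mu k) * Lop k w')
  | pio_int_rb j g : g \in G1 ->
      pio_rel (A j * co (at_slot j g) * A j)
        (co (rbint G j (at_slot j g)) * A j
         - A j * co (rbint G j (at_slot j g))).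

Definition pio := palg pio_rel.

Definition pio_coef (g : G) : pio := pgen pio_rel (GCoef g).
Definition pio_subst (M : infmx K) : pio := pgen pio_rel (GSubst M).
Definition pio_int (i : nat) : pio := pgen pio_rel (GInt i).

End PartialIntegralOperators.

(* odot is a K-algebra homomorphism from G[\int] to End_K(F). *)
Record pio_action (K : fieldType) (G : rb_hierarchy K) (V : lmodType K)
    (odot : pio G -> {linear V -> V}) : Prop := {
  pio_actD : forall a b f, odot (a + b) f = odot a f + odot b f;
  pio_actZ : forall c a f, odot (c *: a) f = c *: odot a f;
  pio_act1 : forall f, odot 1 f = f;
  pio_actM : forall a b f, odot (a * b) f = odot a (odot b f) }.

(* Main.v *)
From HB Require Import structures.
Require Import Defs.
From mathcomp Require Import all_boot all_order all_algebra.
From mathcomp Require Import boolp classical_sets fsbigop ring.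
Import GRing.Theory.
Local Open Scope ring_scope.

Set Implicit Arguments.
Unset Strict Implicit.
Unset Printing Implicit Defensive.

(** A term in the generators evaluates to a linear operator on F, and the
    action exists because each defining relation holds between the
    corresponding operators ([ev_rel]); the congruence generated by the
    relations then respects the evaluation. The relations themselves are rules
    of calculus for iterated integrals of functions f(x_0, x_1, x_2, ...) on
    which M acts by f(x) |-> f(Mx), and this picture is turned into a proof as
    follows.

    Straightness says that M^* f depends only on the rows of M whose variables
    occur in f ([depends]); so it suffices to compare substitutions row by row,
    and there are always fresh variables x_m, not occurring in a given f.
    Conjugating by transpositions extends the axioms from x_0 or from the last
    variable to every x_i: the integral along x_i is linear over elements not
    involving x_i ([int_free_mul]) and commutes with substitutions that do not
    touch x_i ([int_act]).

    The relation for A_j g(x_j) M^* is the substitution rule for one integral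
    ([int_column]). Its proof uses a fresh variable in place of the linear form
    that is added to the integration variable, so that a single elementary
    transvection suffices. The relation for two integrals along different
    variables is Fubini's theorem combined with this rule ([int_int_lt]). For
    two integrals along the same variable, the substitution axiom, transported
    to arbitrary variables and rescaled, gives the case without coefficients
    ([int_int_shear]), and a fresh variable once more makes it possible to move
    the outer coefficient into the inner integral ([int_int_eq]).

    In all these rules the coefficients are functions of one variable which
    become functions of a linear form in several variables; the tensor
    expansion separates the variables again. *)

(** * Matrices as linear substitutions *)

Section Substitution.
Variable K : fieldType.
Implicit Types (M N : infmx K) (x y w : nat -> K) (r c i j : nat).

(** The vector M x. The endomorphism M^* stands for the change of variables
    f(x) |-> f(Mx), so identities between products of matrices are checked
    below as identities between linear substitutions. *)
Definition app M x r : K := \sum_(k \in [set: nat]) (M r k * x k).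

Lemma appE n M x r : in_mx n M -> (r < n)%N ->
  app M x r = \sum_(k < n) M r k * x k.
Proof.
move=> hM rn; rewrite (fsbig_ord _ n (fun k => M r k * x k)).
symmetry; apply: fsbig_widen => // k /= [_ /negP]; rewrite -leqNgt => nk.
by rewrite hM ?nk ?orbT// ltn_eqF ?mul0r// (leq_trans rn nk).
Qed.

Lemma app_ge n M x r : in_mx n M -> (n <= r)%N -> app M x r = x r.
Proof.
move=> hM nr; rewrite (appE _ (in_mx_leq (leqW nr) hM) (leqnn _)).
rewrite big_ord_recr /= hM ?nr// eqxx mul1r big1 ?add0r// => k _.
by rewrite hM ?nr// gtn_eqF ?mul0r.
Qed.

Lemma in_mx_bound M r : exists2 n, in_mx n M & (r < n)%N.
Proof.
have [n hn] := in_mx_ex M; exists (maxn n r.+1); last exact: leq_maxr.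
exact: in_mx_leq (leq_maxl _ _) hn.
Qed.

Lemma app_ext M x y r : x =1 y -> app M x r = app M y r.
Proof. by move=> /funext->. Qed.

Lemma app1 x r : app 1%g x r = x r.
Proof. exact: (@app_ge 0). Qed.

Lemma app_mul M N x r : app (M * N)%g x r = app M (app N x) r.
Proof.
rewrite -[(M * N)%g]/(imul M N).
have [a hM ra] := in_mx_bound M r; have [b hN] := in_mx_ex N.
have [d hMN] := in_mx_ex (imul M N).
pose n := maxn a (maxn b d).
have {}hM : in_mx n M by apply: in_mx_leq hM; rewrite leq_maxl.
have {}hN : in_mx n N by apply: in_mx_leq hN; rewrite !leq_max leqnn orbT.
have {}hMN : in_mx n (imul M N).
  by apply: in_mx_leq hMN; rewrite !leq_max leqnn !orbT.
have rn : (r < n)%N by rewrite leq_max ra.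
rewrite (appE _ hM rn) (appE _ hMN rn).
under [RHS]eq_bigr => k _ do rewrite (appE _ hN (ltn_ord k)) mulr_sumr.
rewrite exchange_big; apply: eq_bigr => k _.
rewrite (imulE _ _ hM rn) mulr_suml; apply: eq_bigr => l _.
by rewrite mulrA.
Qed.

Definition unitv c : nat -> K := fun r => (r == c)%:R.

Lemma app_unitv M r c : app M (unitv c) r = M r c.
Proof.
have [n hM] := in_mx_bound M (maxn r c); rewrite gtn_max => /andP[rn cn].
rewrite (appE _ hM rn) (bigD1 (Ordinal cn))//= /unitv eqxx mulr1.
rewrite big1 ?addr0// => k; rewrite -val_eqE /= => /negbTE->.
by rewrite mulr0.
Qed.

Lemma app0 M r : app M (fun=> 0) r = 0.
Proof.
have [n hM rn] := in_mx_bound M r.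
by rewrite (appE _ hM rn) big1// => k _; rewrite mulr0.
Qed.

Lemma app_lin M a x y r :
  app M (fun c => a * x c + y c) r = a * app M x r + app M y r.
Proof.
have [n hM rn] := in_mx_bound M r.
rewrite !(appE _ hM rn) mulr_sumr -big_split /=; apply: eq_bigr => k _.
by rewrite mulrDr mulrCA.
Qed.

Lemma app_inj M N : (forall x r, app M x r = app N x r) -> M = N.
Proof. by move=> h; apply: imx_eq => r c; rewrite -!app_unitv h. Qed.

Lemma sum_delta n (x : nat -> K) i : (i < n)%N ->
  \sum_(k < n) (k == i :> nat)%:R * x k = x i.
Proof.
move=> hi; rewrite (bigD1 (Ordinal hi))//= eqxx mul1r big1 ?addr0// => k.
by rewrite -val_eqE /= => /negbTE->; rewrite mul0r.
Qed.

Lemma app_row1 M x r i a : (forall c, M r c = a *+ (c == i)) ->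
  app M x r = a * x i.
Proof.
move=> h; have [n hM] := in_mx_bound M (maxn r i).
rewrite gtn_max => /andP[rn hi]; rewrite (appE _ hM rn) -(sum_delta x hi).
rewrite mulr_sumr; apply: eq_bigr => k _.
by rewrite h mulr_natl mulrnAl mulrnAr.
Qed.

Lemma app_row2 M x r i k a b :
  (forall c, M r c = a *+ (c == i) + b *+ (c == k)) ->
  app M x r = a * x i + b * x k.
Proof.
move=> h; have [n hM] := in_mx_bound M (maxn r (maxn i k)).
rewrite !gtn_max => /and3P[rn hi hk]; rewrite (appE _ hM rn).
rewrite -(sum_delta x hi) -(sum_delta x hk) !mulr_sumr -big_split.
apply: eq_bigr => l _ /=.
by rewrite h !mulr_natl !mulrnAr mulrDl !mulrnAl.
Qed.

Lemma app_row_eq M N x r : (forall c, M r c = N r c) -> app M x r = app N x r.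
Proof. by move=> h; apply: eq_fsbigr => c _; rewrite h. Qed.

Lemma app_diag i a x r :
  app (imx_diag i a) x r = (if r == i then a else 1) * x r.
Proof.
apply: app_row1 => c /=.
by case: (eqVneq r i) => [->|_]//; rewrite eq_sym.
Qed.

Lemma app_E i x r : app (imxE K i) x r = if r == i then 0 else x r.
Proof. by rewrite app_diag; case: eqP; rewrite ?mul0r ?mul1r. Qed.

Lemma app_tperm i j x r : app (imx_tperm K i j) x r = x (imx_swap i j r).
Proof.
by rewrite (@app_row1 _ _ _ (imx_swap i j r) 1) ?mul1r// => c;
  rewrite /= eq_sym.
Qed.

Lemma imx_of_in n (M : 'M[K]_n) : in_mx n (imx_of M).
Proof.
move=> r c /orP[] h /=; rewrite /imx_of_entry;
  first by rewrite insubN// -leqNgt.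
by case: (insub r) => // r'; rewrite insubN// -leqNgt.
Qed.

Lemma imx_ofE n (M : 'M[K]_n) (r c : 'I_n) : imx_of M r c = M r c.
Proof. by rewrite /= /imx_of_entry !valK. Qed.

Lemma app_imx_of n (M : 'M[K]_n) x (r : 'I_n) :
  app (imx_of M) x r = \sum_k M r k * x k.
Proof.
rewrite (appE _ (@imx_of_in _ M) (ltn_ord r)).
by apply: eq_bigr => k _; rewrite imx_ofE.
Qed.

Lemma imx_of_mul n (M N : 'M[K]_n) : imx_of (M *m N) = (imx_of M * imx_of N)%g.
Proof.
apply: app_inj => x r; rewrite app_mul; case: (ltnP r n) => rn; last first.
  by rewrite !(app_ge _ (@imx_of_in _ _) rn).
rewrite !(app_imx_of _ _ (Ordinal rn)).
under eq_bigr => k _ do rewrite mxE mulr_suml.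
rewrite exchange_big; apply: eq_bigr => k _ /=; rewrite app_imx_of mulr_sumr.
by apply: eq_bigr => l _; rewrite mulrA.
Qed.

Lemma app_rowmx n (a : 'rV[K]_n) x : (0 < n)%N ->
  app (imx_of (rowmx a)) x 0%N = \sum_k a 0 k * x k.
Proof.
move=> n0; rewrite (app_imx_of _ _ (Ordinal n0)).
by apply: eq_bigr => k _; rewrite mxE.
Qed.

(** Matrices are specified by their effect on vectors, here x |-> x + x_a w.
    The specification determines the matrix, and it is compatible with
    conjugation by permutations and by diagonal matrices. *)
Definition shears a w M := forall x r, app M x r = x r + w r * x a.

Lemma shears_ex a w n : (a < n)%N -> (forall r, (n <= r)%N -> w r = 0) ->
  exists M, shears a w M.
Proof.
move=> an wn.
have fin : exists n, forall r c : nat, (n <= r)%N || (n <= c)%N ->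
    1 *+ (c == r) + w r *+ (c == a) = (r == c)%:R.
  exists n => r c /orP[] h; rewrite [c == r]eq_sym;
    first by rewrite wn// mul0rn addr0.
  by rewrite [c == a]gtn_eqF ?addr0// (leq_trans an h).
exists (InfMx fin) => x r; rewrite (@app_row2 _ _ _ r a 1 (w r)) ?mul1r// => c.
Qed.

Lemma app_mask M x i r :
  app M (app (imxE K i) x) r = app M x r - M r i * x i.
Proof.
rewrite -app_unitv mulrC addrC -mulNr -app_lin; apply: app_ext => c.
rewrite app_E /unitv; case: eqP => [->|_]; first by rewrite mulr1 addNr.
by rewrite mulr0 add0r.
Qed.

Lemma shears_support a w M : shears a w M ->
  exists n, forall r, (n <= r)%N -> w r = 0.
Proof.
move=> hM; have [n hn] := in_mx_ex M; exists n => r nr.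
have := hM (fun=> 1) r; rewrite (app_ge _ hn)// mulr1.
by move/eqP; rewrite -subr_eq0 opprD addNKr oppr_eq0 => /eqP.
Qed.

(** The vector w for which the matrix [Lmx i v] is x |-> x + x_i w. *)
Definition tail n (i : 'I_n) (v : 'cV[K]_n) (r : nat) : K :=
  if insub r is Some s then (v s 0) *+ (i < r)%N else 0.

Lemma tailE n (i r : 'I_n) v : tail i v r = (v r 0) *+ (i < r)%N.
Proof. by rewrite /tail valK. Qed.

Lemma tail_ge n (i : 'I_n) v r : (n <= r)%N -> tail i v r = 0.
Proof. by move=> h; rewrite /tail insubN// -leqNgt. Qed.

Lemma tail_le n (i : 'I_n) v r : (r <= i)%N -> tail i v r = 0.
Proof. by rewrite /tail; case: insubP => // s _ _;
  rewrite leqNgt => /negbTE->. Qed.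

Lemma tailD n (i : 'I_n) u v r : tail i (u + v) r = tail i u r + tail i v r.
Proof. by rewrite /tail; case: insubP => [s _ _|_];
  rewrite ?addr0// mxE mulrnDl. Qed.

Lemma tailZ n (i : 'I_n) a v r : tail i (a *: v) r = a * tail i v r.
Proof. by rewrite /tail; case: insubP => [s _ _|_];
  rewrite ?mulr0// mxE mulrnAr. Qed.

Lemma tailN n (i : 'I_n) v r : tail i (- v) r = - tail i v r.
Proof. by rewrite -scaleN1r tailZ mulN1r. Qed.

Lemma tail_delta n (i k : 'I_n) r : (i < k)%N ->
  tail i (delta_mx k 0) r = (r == k)%:R.
Proof.
move=> ik; rewrite /tail; case: insubP => [s _ <-|].
  by rewrite mxE eqxx andbT -val_eqE; case: eqP => [->|_]; rewrite ?ik ?mul0rn.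
by rewrite -leqNgt => nr; rewrite gtn_eqF// (leq_trans _ nr).
Qed.

Lemma Lmx_shears n (i : 'I_n) (v : 'cV[K]_n) :
  shears i (tail i v) (imx_of (Lmx i v)).
Proof.
move=> x r; case: (ltnP r n) => rn; last first.
  by rewrite (app_ge _ (@imx_of_in _ _) rn) tail_ge// mul0r addr0.
rewrite (app_imx_of _ _ (Ordinal rn)) (tailE _ (Ordinal rn)) -(sum_delta x
  (ltn_ord i)).
rewrite -(sum_delta x rn) mulr_sumr -big_split /=; apply: eq_bigr => k _.
rewrite mxE mulrDl -val_eqE eq_sym /=; congr (_ + _).
rewrite -[k == i]val_eqE; case: (val k == val i);
  by rewrite ?andbT ?andbF ?mul1r ?mul0r ?mulr0.
Qed.

Lemma tail_Lmx n (i k : 'I_n) (w v : 'cV[K]_n) r : (i < k)%N ->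
  tail i (Lmx k w *m v) r = tail i v r + tail k w r * v k 0.
Proof.
move=> ik; rewrite /tail; case: insubP => [s _ <-|_];
  last by rewrite mul0r addr0.
rewrite mxE; have := Lmx_shears k w (fun c => if insub c is Some t then v t 0
  else 0) s.
rewrite app_imx_of !valK tailE => e.
rewrite (_ : \sum_j _ = v s 0 + w s 0 *+ (k < s)%N * v k 0); last first.
  by rewrite -e; apply: eq_bigr => t _; rewrite valK.
rewrite mulrnDl; congr (_ + _); case: (ltnP k s) => ks;
  last by rewrite mul0r mul0rn.
by rewrite (ltn_trans ik ks).
Qed.

Lemma imx_swapC i j r : imx_swap i j r = imx_swap j i r.
Proof. by rewrite /imx_swap; case: (eqVneq r i) => [->|]//;
  case: (eqVneq i j). Qed.

Lemma imx_swapK i j : involutive (imx_swap i j).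
Proof.
move=> r; rewrite /imx_swap; have [->|ri] := eqVneq r i.
  by rewrite eqxx; case: (eqVneq j i).
by have [->|rj] := eqVneq r j; rewrite ?eqxx// (negbTE ri) (negbTE rj).
Qed.

Lemma imx_swapl i j : imx_swap i j i = j.
Proof. by rewrite /imx_swap eqxx. Qed.

Lemma imx_swapr i j : imx_swap i j j = i.
Proof. by rewrite imx_swapC imx_swapl. Qed.

Lemma imx_swapD i j r : r != i -> r != j -> imx_swap i j r = r.
Proof. by rewrite /imx_swap => /negbTE-> /negbTE->. Qed.

Lemma imx_swap_eq i j r c : (imx_swap i j r == c) = (r == imx_swap i j c).
Proof. by rewrite -{2}[r](imx_swapK i j) (inj_eq (inv_inj (imx_swapK i j))).
Qed.

Lemma imx_tpermC i j : imx_tperm K i j = imx_tperm K j i.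
Proof. by apply: app_inj => x r; rewrite !app_tperm imx_swapC. Qed.

Lemma imx_tpermK i j : (imx_tperm K i j * imx_tperm K i j)%g = 1%g.
Proof. by apply: app_inj => x r; rewrite app_mul !app_tperm imx_swapK app1. Qed.

End Substitution.

(** * The variables that an element of a hierarchy depends on *)

Section Dependence.
Variables (K : fieldType) (F : hierarchy K).
Implicit Types (M N : infmx K) (f g u : F) (P Q : pred nat) (x y : nat -> K).

(** f involves only the variables x_r with P r: the substitution M affects f
    only through the rows r of M with P r. Straightness says that f in F_n
    depends on the x_r with r < n, and every f fixed by E_i depends on the x_r
    other than x_i; hence f can be treated as a function of its variables. *)
Definition depends f P := forall M N,
  (forall r, P r -> forall x, app M x r = app N x r) -> hact F M f = hact F N f.

Lemma hact_mul M f g : hact F M (f * g) = hact F M f * hact F M g.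
Proof. exact: rmorphM. Qed.

Lemma hact_sub M f g : hact F M (f - g) = hact F M f - hact F M g.
Proof. exact: rmorphB. Qed.

Lemma hact_sum M I (s : seq I) (f : I -> F) :
  hact F M (\sum_(i <- s) f i) = \sum_(i <- s) hact F M (f i).
Proof. exact: rmorph_sum. Qed.

Lemma hact_prod M I (s : seq I) (p : pred I) (f : I -> F) :
  hact F M (\prod_(i <- s | p i) f i) = \prod_(i <- s | p i) hact F M (f i).
Proof. exact: rmorph_prod. Qed.

Lemma hact_scale M a f : hact F M (a *: f) = a *: hact F M f.
Proof. exact: linearZ. Qed.

Lemma hact_comp M N f : hact F N (hact F M f) = hact F (M * N)%g f.
Proof. by rewrite hactM. Qed.

Lemma depends_comp n f : f \in hcomp F n -> depends f (fun r => r < n)%N.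
Proof.
move=> fn M N h; rewrite (hact_straight M fn) (hact_straight N fn).
congr (hact F _ f); apply: imx_eq => r c /=; case: ifP => // rn.
by rewrite -!app_unitv h.
Qed.

Lemma depends_mono f P Q : {subset P <= Q} -> depends f P -> depends f Q.
Proof. by move=> PQ h M N e; apply: h => r /PQ; apply: e. Qed.

Lemma depends_id f P M : depends f P ->
  (forall r, P r -> forall x, app M x r = x r) -> hact F M f = f.
Proof.
move=> h e; rewrite -[RHS](hact1 (h:=F)); apply: h => r /e + x => ->.
by rewrite app1.
Qed.

Lemma dependsM f g P : depends f P -> depends g P -> depends (f * g) P.
Proof. by move=> hf hg M N h; rewrite !hact_mul (hf M N)// (hg M N). Qed.

Lemma dependsB f g P : depends f P -> depends g P -> depends (f - g) P.
Proof. by move=> hf hg M N h; rewrite !hact_sub (hf M N)// (hg M N). Qed.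

Lemma depends_prod I (s : seq I) (p : pred I) (f : I -> F) P :
  (forall i, p i -> depends (f i) P) -> depends (\prod_(i <- s | p i) f i) P.
Proof.
move=> h; elim/big_rec: _ => [M N _|i g pi hg]; first by rewrite !rmorph1.
by apply: dependsM => //; apply: h.
Qed.

Lemma depends_act M f P Q : depends f P ->
  (forall r, P r -> forall x y, (forall c, Q c -> x c = y c) ->
    app M x r = app M y r) -> depends (hact F M f) Q.
Proof.
move=> hf h A B e; rewrite !hact_comp; apply: hf => r Pr x.
by rewrite !app_mul; apply: h => // c Qc; apply: e.
Qed.

Definition free_of i : pred nat := fun r => r != i.

Lemma free_ofP i f : depends f (free_of i) <-> hact F (imxE K i) f = f.
Proof.
split=> [h|h M N e].
  by apply: depends_id h _ => r /negbTE ri x; rewrite app_E ri.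
rewrite -h !hact_comp; congr (hact F _ f).
by apply: app_inj => x r; rewrite !app_mul !app_E; case: eqP => // /eqP /e.
Qed.

Lemma free_comp n i f : (n <= i)%N -> f \in hcomp F n -> depends f (free_of i).
Proof.
move=> ni /depends_comp; apply: depends_mono => r /= rn.
by rewrite unfold_in /free_of ltn_eqF// (leq_trans rn ni).
Qed.

Lemma hcomp_leq n m f : (n <= m)%N -> f \in hcomp F n -> f \in hcomp F m.
Proof.
move=> /subnKC <-; elim: (m - n)%N => [|k IH]; rewrite ?addn0// addnS => /IH.
exact: hcompS.
Qed.

Lemma hcomp_bound n f : exists2 m, (n <= m)%N & f \in hcomp F m.
Proof.
have [m hm] := hcomp_union f; exists (maxn n m); first exact: leq_maxl.
by apply: hcomp_leq hm; apply: leq_maxr.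
Qed.

Lemma free_hcomp n f : f \in hcomp F n.+1 -> depends f (free_of n) ->
  f \in hcomp F n.
Proof. by move=> h /free_ofP<-; apply: hactE. Qed.

Lemma tpermK i j f : hact F (imx_tperm K i j) (hact F (imx_tperm K i j) f) = f.
Proof. by rewrite hact_comp imx_tpermK hact1. Qed.

Lemma tperm_hcomp i j n f : (i < n)%N -> (j < n)%N -> f \in hcomp F n ->
  hact F (imx_tperm K i j) f \in hcomp F n.
Proof.
move=> hi hj; apply: hact_stable => r c h /=; congr (_%:R);
  congr (nat_of_bool _).
case/orP: h => h; last rewrite imx_swap_eq ![_ == c]eq_sym.
  rewrite imx_swapD// gtn_eqF//; exact: leq_trans h.
rewrite eq_sym imx_swapD// gtn_eqF//; exact: leq_trans h.
Qed.

Lemma tperm_free i j k f : depends f (free_of k) ->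
  depends (hact F (imx_tperm K i j) f) (free_of (imx_swap i j k)).
Proof.
move=> h; apply: depends_act h _ => r rk x y; rewrite !app_tperm; apply.
by rewrite /free_of (inj_eq (inv_inj (imx_swapK i j))).
Qed.

End Dependence.

(** * A single integral: linearity and linear substitutions *)

Section Integrals.
Variables (K : fieldType) (F : rb_hierarchy K).
Implicit Types (M N : infmx K) (f g u : F) (P Q : pred nat) (x y : nat -> K).
Local Notation act := (hact F).
Local Notation int := (rbint F).
Local Notation tau i j := (hact F (imx_tperm K i j)).

Lemma int_tperm i j f : int i f = tau i j (int j (tau i j f)).
Proof. by rewrite -rbint_tperm tpermK. Qed.

(** The evaluation axiom gives this on the component in which x_i is the last
    variable. An arbitrary f lies in some F_{n+1}, where exchanging x_i and x_n
    makes it the last variable. *)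
Lemma mask_int i f : act (imxE K i) (int i f) = 0.
Proof.
have [[|n]// + fn] := hcomp_bound i.+1 f; rewrite ltnS => lein.
have tn : tau i n f \in hcomp F n.+1 by apply: tperm_hcomp.
have e : act (imxE K n) (int n (tau i n f)) = 0.
  have [h0 _] := GRing.subalg_closedZ (@hcomp_subalg K F n).
  by have := @rbint_eval K F n 0 _ _ tn; rewrite add0r; apply; apply: h0.
rewrite (int_tperm i n) hact_comp (_ : (_ * _)%g = (imxE K n * imx_tperm K i
  n)%g).
  by rewrite -hact_comp e rmorph0.
apply: app_inj => x r; rewrite !app_mul !app_tperm !app_E imx_swap_eq imx_swapl.
by case: eqP => //; rewrite app_tperm.
Qed.

Lemma int_scale i a f : int i (a *: f) = a *: int i f.
Proof. exact: linearZ. Qed.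

Lemma int_sub i f g : int i (f - g) = int i f - int i g.
Proof. exact: raddfB. Qed.

Lemma int_sum i I (s : seq I) (f : I -> F) :
  int i (\sum_(k <- s) f k) = \sum_(k <- s) int i (f k).
Proof. exact: raddf_sum. Qed.

(** M has the block form diag(1, M') in which the entry 1 belongs to x_i: the
    substitution M neither changes x_i nor makes other variables depend on
    it. *)
Definition fixes i M := (forall x, app M x i = x i) /\
  forall x y r, r != i -> (forall c, c != i -> x c = y c) ->
    app M x r = app M y r.

(** The axiom covers the matrices diag(1, M') and the integral along x_0; the
    transposition of x_0 and x_i carries it to x_i. *)
Lemma int_act i M f : fixes i M -> int i (act M f) = act M (int i f).
Proof.
move=> [hi hr]; pose T := imx_tperm K 0 i; pose N := (T * (M * T))%g.
have eM : M = (T * (N * T))%g.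
  by apply: app_inj => x r; rewrite !(app_mul, app_tperm) imx_swapK;
    apply: app_ext => c; rewrite !app_tperm imx_swapK.
have hN : in_tmx 1 N.
  move=> r c; rewrite !ltnS !leqn0 -app_unitv !(app_mul, app_tperm).
  have [->|r0] := eqVneq r 0%N.
    by rewrite imx_swapl hi app_tperm imx_swapr.
  move=> /eqP->; rewrite (hr _ (fun=> 0)) => [||k ki].
  - by rewrite app0 (negbTE r0).
  - by rewrite imx_swap_eq imx_swapr.
  - by rewrite app_tperm /unitv imx_swap_eq imx_swapl (negbTE ki).
clearbody N; rewrite eM -!hact_comp -rbint_tperm (rbint_act (ltnSn 0) hN).
by rewrite /T imx_tpermC -rbint_tperm.
Qed.

Lemma fixes_tperm i p q : i != p -> i != q -> fixes i (imx_tperm K p q).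
Proof.
move=> ip iq; split=> [x|x y r ri h]; first by rewrite app_tperm imx_swapD.
by rewrite !app_tperm h// imx_swap_eq imx_swapD.
Qed.

Lemma fixes_diag i k a : i != k -> fixes i (imx_diag k a).
Proof.
move=> ik; split=> [x|x y r ri h]; first by rewrite app_diag (negbTE ik) mul1r.
by rewrite !app_diag h.
Qed.

Lemma fixes_shears i a w M : shears a w M -> a != i -> w i = 0 -> fixes i M.
Proof.
move=> hM ai wi; split=> [x|x y r ri h]; first by rewrite hM wi mul0r addr0.
by rewrite !hM !h.
Qed.

Lemma int_tperm_swap i j k f :
  tau i j (int k f) = int (imx_swap i j k) (tau i j f).
Proof.
have [->|ki] := eqVneq k i; first by rewrite imx_swapl rbint_tperm.
have [->|kj] := eqVneq k j.
  by rewrite imx_swapr imx_tpermC rbint_tperm imx_tpermC.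
by rewrite imx_swapD// int_act//; apply: fixes_tperm.
Qed.

Lemma tperm_mask i j k f :
  tau i j (act (imxE K k) f) = act (imxE K (imx_swap i j k)) (tau i j f).
Proof.
rewrite !hact_comp; congr (act _ f); apply: app_inj => x r.
by rewrite !(app_mul, app_tperm, app_E) (inj_eq (inv_inj (imx_swapK i j))).
Qed.

(** A factor without x_i can be pulled out of the integral along x_i: once x_i
    is exchanged with the last variable x_n, such a factor lies in F_n, over
    which the integral along x_n is linear. *)
Lemma int_free_mul i f u : depends f (free_of i) -> int i (f * u) = f * int i u.
Proof.
move=> fi; have [n1 ln1 fn1] := hcomp_bound i.+1 f.
have [m lm um] := hcomp_bound n1 u.
have {n1 ln1 lm fn1} [lim fm] : (i < m)%N /\ f \in hcomp F m.
  by split; [apply: leq_trans lm | apply: hcomp_leq fn1].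
case: m lim um fm => // n ln1 un fn.
rewrite (int_tperm i n) hact_mul (orb_lin (rbint_ordinary F n)).
- by rewrite hact_mul tpermK -int_tperm.
- apply: free_hcomp; first exact: tperm_hcomp.
  by rewrite -{2}(imx_swapl i n); apply: tperm_free.
- exact: tperm_hcomp.
Qed.

Lemma depends_int i j f : j != i -> depends f (free_of i) ->
  depends (int j f) (free_of i).
Proof.
move=> ji /free_ofP fi; apply/free_ofP; rewrite -int_act ?fi//.
exact: fixes_diag.
Qed.

(** The axiom is the case m = 1; exchanging x_1 and x_m does not affect the
    integral along x_0. *)
Lemma int_transvection m M f : (0 < m)%N -> shears m (unitv K 0) M ->
  int 0 (act M f) = act M (int 0 f) - act (imxE K 0) (act M (int 0 f)).
Proof.
move=> m0 hM; pose T := imx_of (1%:M + delta_mx (0 : 'I_2) 1) : infmx K.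
have hT x r : app T x r = x r + unitv K 0 r * x 1%N.
  case: (ltnP r 2) => hr; last first.
    rewrite (app_ge _ (@imx_of_in _ _ _) hr) /unitv gtn_eqF ?mul0r ?addr0//.
    exact: leq_trans hr.
  rewrite (app_imx_of _ _ (Ordinal hr)) !big_ord_recl big_ord0 !mxE /= addr0.
  by case: r hr => [|[|]]// hr; rewrite /unitv /= !(mul0r, mul1r, add0r, addr0).
have eM : M = (imx_tperm K 1 m * (T * imx_tperm K 1 m))%g.
  apply: app_inj => x r; rewrite hM !(app_mul, app_tperm, hT) imx_swapK.
  by rewrite imx_swapl /unitv imx_swap_eq [imx_swap _ _ 0]imx_swapD// ltn_eqF.
have h1 g : int 0 (tau 1 m g) = tau 1 m (int 0 g).
  by rewrite int_tperm_swap imx_swapD// ltn_eqF.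
have hTi g : int 0 (act T g) = act T (int 0 g) - act (imxE K 0) (act T (int 0
  g)).
  exact: rbint_transvection.
clearbody T; rewrite eM -!hact_comp h1 hTi hact_sub h1; congr (_ - _).
by rewrite tperm_mask imx_swapD// ltn_eqF.
Qed.

(** The substitution in question is x_0 |-> lam x_0 + rho, where rho is a
    linear form in the other variables, together with linear changes of the
    latter. For u in F_m it is performed in two steps: x_0 |-> lam x_0 + x_m
    with the fresh variable x_m, which is covered by the axioms for scalings
    and for transvections, and then a substitution diag(1, D') that replaces
    x_m by rho; the latter commutes with the integral. *)
Lemma int_column0 N lam u : lam != 0 -> N 0%N 0%N = lam ->
    (forall r, r != 0%N -> N r 0%N = 0) ->
  int 0 (act N u)
    = lam^-1 *: (act N (int 0 u) - act (imxE K 0) (act N (int 0 u))).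
Proof.
move=> lam0 N0 Nr; have [n hN _] := in_mx_bound N 0.
have [m lem um] := hcomp_bound n.+1 u;
  have m0 : (0 < m)%N by apply: leq_trans lem.
have {hN lem} hN : in_mx m N := in_mx_leq (ltnW lem) hN.
have m0F : (m == 0%N) = false by rewrite gtn_eqF.
pose D r c := if r == 0%N then (c == 0%N)%:R else
  if r == m then N 0%N c - lam * (c == 0%N)%:R else N r c.
have hD r c : (m < r)%N || (m < c)%N -> D r c = (r == c)%:R.
  rewrite /D => h; case: (eqVneq r 0%N) => [->|r0]; first by case: c {h}.
  case: (eqVneq r m) => rm; last by apply: hN; case/orP: h => /ltnW->;
    rewrite ?orbT.
  have {h} cm : (m < c)%N by move: h; rewrite rm ltnn.
  have c0 : (c == 0%N) = false by rewrite gtn_eqF// (leq_trans _ cm).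
  by rewrite c0 mulr0 subr0 hN ?(ltnW cm) ?orbT// eq_sym c0 rm ltn_eqF.
have Dfin : exists n, forall r c : nat, (n <= r)%N || (n <= c)%N ->
  D r c = (r == c)%:R by exists m.+1.
pose DM := InfMx Dfin.
have D0 x : app DM x 0%N = x 0%N.
  by rewrite (@app_row1 _ _ _ _ 0 1) ?mul1r// => c.
have Dm x : app DM x m = app N x 0%N - lam * x 0%N.
  have hN' := in_mx_leq (leqnSn m) hN.
  rewrite (@appE _ m.+1 DM)// (appE _ hN')// -(sum_delta x (ltn0Sn m)).
  rewrite mulr_sumr -sumrB; apply: eq_bigr => k _.
  by rewrite /= /D m0F eqxx mulrBl mulrA.
have Dr x r : r != 0%N -> r != m -> app DM x r = app N x r.
  by move=> r0 rm; apply: app_row_eq => c;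
    rewrite /= /D (negbTE r0) (negbTE rm).
have tD : in_tmx 1 DM.
  move=> r c; rewrite !ltnS !leqn0 /= /D;
    case: (eqVneq r 0%N) => [-> _|r0 /eqP->].
    by rewrite eq_sym.
  by case: eqP => _; rewrite (negbTE r0) ?eqxx ?N0 ?mulr1 ?subrr ?Nr.
have [T hT] : exists T, shears m (unitv K 0) T.
  by apply: (@shears_ex _ _ _ m.+1) => // r rm;
    rewrite /unitv gtn_eqF// (leq_trans _ rm).
have ND f : f \in hcomp F m -> act N f = act DM (act (imx_diag 0 lam) (act T
  f)).
  move=> fm; rewrite !hact_comp; apply: (depends_comp fm) => r rm x.
  rewrite !(app_mul, hT, app_diag) /unitv m0F mul1r Dm.
  have [->|r0] := eqVneq r 0%N; first by rewrite D0 mul1r; ring.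
  by rewrite mul0r addr0 mul1r Dr// ltn_eqF.
rewrite ND// (rbint_act (ltnSn 0) tD) (rbint_scale lam0) hact_scale.
rewrite (int_transvection _ m0 hT) !hact_sub; congr (_ *: (_ - _)).
  by rewrite ND//; apply: rbint_stable.
rewrite !hact_comp; apply: (depends_comp (rbint_stable m0 um)) => r rm x.
rewrite !(app_mul, app_mask, hT, app_E, app_diag) /unitv m0F mul1r Dm.
have [->|r0] := eqVneq r 0%N; first by rewrite N0 add0r mul1r.
by rewrite Nr// !mul0r subr0 addr0 mul1r Dr// ltn_eqF.
Qed.

(** Substitution rule for one integral: when x_j enters N x only through the
    i-th coordinate, where it has the coefficient lam, the integral of N^* u
    along x_j is an integral of u along x_i. The term with E_j is the
    contribution of the lower limit, which N shifts away from 0. *)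
Lemma int_column i j N lam u : lam != 0 -> N i j = lam ->
    (forall r, r != i -> N r j = 0) ->
  int j (act N u)
    = lam^-1 *: (act N (int i u) - act (imxE K j) (act N (int i u))).
Proof.
move=> lam0 Nij Nr; pose N' := (imx_tperm K 0 i * (N * imx_tperm K 0 j))%g.
have eN' r c : N' r c = N (imx_swap 0 i r) (imx_swap 0 j c).
  rewrite -app_unitv !(app_mul, app_tperm) -app_unitv; apply: app_ext => k.
  by rewrite app_tperm /unitv imx_swap_eq.
have eN : N = (imx_tperm K 0 i * (N' * imx_tperm K 0 j))%g.
  by apply: app_inj => x r; rewrite !(app_mul, app_tperm) imx_swapK;
    apply: app_ext => c; rewrite !app_tperm imx_swapK.
clearbody N'; rewrite eN -!hact_comp -rbint_tperm (@int_column0 N' lam)//;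
  first last.
- by move=> r r0; rewrite eN' imx_swapl Nr// imx_swap_eq imx_swapr.
- by rewrite eN' !imx_swapl.
rewrite hact_scale hact_sub tperm_mask imx_swapl.
by rewrite [imx_tperm K 0 i]imx_tpermC -rbint_tperm.
Qed.

Lemma at_slot_depends k g : g \in hcomp F 1 -> depends (at_slot k g) (pred1 k).
Proof.
move=> g1 M N h; rewrite /at_slot !hact_comp;
  apply: (depends_comp g1) => -[|//] _ x.
by rewrite !app_mul !app_tperm imx_swapl; apply: h => /=.
Qed.

Lemma at_slot_free g k i :
  k != i -> g \in hcomp F 1 -> depends (at_slot k g) (free_of i).
Proof.
by move=> ki /(@at_slot_depends k); apply: depends_mono => r /eqP->.
Qed.

(** * Two nested integrals along the same variable *)

Lemma shears_ext a w w' M : w =1 w' -> shears a w M -> shears a w' M.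
Proof. by move=> e h x r; rewrite h e. Qed.

Lemma shears_uniq a w w' M N :
  w =1 w' -> shears a w M -> shears a w' N -> M = N.
Proof. by move=> e hM hN; apply: app_inj => x r; rewrite hM hN e. Qed.

Definition erase b w : nat -> K := fun r => if r == b then 0 else w r.

(** The substitution axiom for the variables x_a and x_b in place of x_0 and
    x_1. Here L = L_a(w), S = L_a(e_b), while M and N are L_b(+-w) without the
    coordinate b of w. *)
Definition substitution_rule a b := forall w L S M N u, w a = 0 -> w b = 1 ->
  shears a w L -> shears a (unitv K b) S -> shears b (erase b w) M ->
  shears b (fun r => - erase b w r) N ->
  int a (act L (int a u))
    = act N (act S (int a (int b (act M u))) - int a (act S (int b (act M u)))).

Lemma substitution_rule01 : substitution_rule 0 1.
Proof.
move=> w L S M N u w0 w1 hL hS hM hN; have [n hn] := shears_support hL.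
have wn r : (n.+2 <= r)%N -> w r = 0 by move=> nr; rewrite hn// ltnW// ltnW.
pose v : 'cV[K]_n.+2 := \col_r erase 1 w r.
have tv (i : 'I_n.+2) r : tail i v r = erase 1 w r *+ (i < r)%N.
  case: (ltnP r n.+2) => rn; first by rewrite (tailE _ (Ordinal rn)) mxE.
  by rewrite tail_ge// /erase wn// if_same mul0rn.
have v1 : v 1 0 = 0 by rewrite mxE.
have eL : imx_of (Lmx (0 : 'I_n.+2) (delta_mx 1 0 + v)) = L.
  apply: (shears_uniq (a := 0)) hL; last exact: Lmx_shears.
  move=> r; rewrite tailD tv tail_delta// /erase.
  by case: r => [|[|r]]/=; rewrite ?w0 ?w1 ?mulr0n ?addr0 ?add0r.
have eS : imx_of (Lmx (0 : 'I_n.+2) (delta_mx 1 0)) = S.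
  apply: (shears_uniq (a := 0)) hS; last exact: Lmx_shears.
  by move=> r; rewrite tail_delta.
have eM : imx_of (Lmx (1 : 'I_n.+2) v) = M.
  apply: (shears_uniq (a := 1)) hM; last exact: Lmx_shears.
  by move=> r; rewrite tv /erase; case: r => [|[|r]]//=; rewrite w0.
have eN : imx_of (Lmx (1 : 'I_n.+2) (- v)) = N.
  apply: (shears_uniq (a := 1)) hN; last exact: Lmx_shears.
  by move=> r; rewrite tailN tv /erase; case: r => [|[|r]]//=; rewrite w0.
by have := rbint_substitution v1 u; rewrite /= eL eS eM eN.
Qed.

Lemma tperm_act i j M f : tau i j (act M f)
  = act (imx_tperm K i j * (M * imx_tperm K i j))%g (tau i j f).
Proof.
rewrite !hact_comp; congr (act _ f); apply: app_inj => x r.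
by rewrite !(app_mul, app_tperm) imx_swapK.
Qed.

Lemma shears_tperm i j a w M : shears (imx_swap i j a) w M ->
  shears a (w \o imx_swap i j) (imx_tperm K i j * (M * imx_tperm K i j))%g.
Proof. by move=> h x r; rewrite !(app_mul, app_tperm, h) !imx_swapK. Qed.

Lemma substitution_rule_tperm i j a b : substitution_rule a b ->
  substitution_rule (imx_swap i j a) (imx_swap i j b).
Proof.
move=> hab w L S M N u wa wb hL hS hM hN; pose s := imx_swap i j.
apply: (can_inj (tpermK (F := F) i j)).
rewrite [RHS]tperm_act hact_sub !(int_tperm_swap, tperm_act) !imx_swapK.
apply: (hab (w \o s)) => //; do ?exact: shears_tperm.
- by apply: shears_ext (shears_tperm hS) => r;
  rewrite /unitv /= imx_swap_eq imx_swapK.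
- by apply: shears_ext (shears_tperm hM) => r;
  rewrite /erase /= imx_swap_eq imx_swapK.
- by apply: shears_ext (shears_tperm hN) => r;
  rewrite /erase /= imx_swap_eq imx_swapK.
Qed.

(** Exchanging first 1 and b, then 0 and a, maps (0, 1) to (a, b); since 0 < b
    and a < b, the first exchange does not move 0 and the second does not move
    b. *)
Lemma substitution_ruleP a b : (a < b)%N -> substitution_rule a b.
Proof.
move=> ab; have b0 : (0 < b)%N by apply: leq_trans ab.
have := substitution_rule_tperm (i:=1) (j:=b) substitution_rule01.
rewrite imx_swapl imx_swapD// ?(ltn_eqF b0)//.
move/(substitution_rule_tperm (i:=0) (j:=a)).
by rewrite imx_swapl imx_swapD// gtn_eqF.
Qed.

(** The inner integral over x_a, evaluated at the moving point x + x_a w and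
    integrated over x_a again, is an integral over a triangle; in suitable
    coordinates it is a difference of two iterated integrals along x_b and x_a.
    The diagonal matrix d rescales x_b and thereby reduces to w_b = 1, and the
    Jacobian of d produces the factor 1 / w_b. *)
Lemma int_int_shear a b w L S M N u : (a < b)%N -> w a = 0 -> w b != 0 ->
  shears a w L -> shears a (fun r => w b * unitv K b r) S ->
  shears b (fun r => erase b w r / w b) M ->
  shears b (fun r => - (erase b w r / w b)) N ->
  int a (act L (int a u)) = (w b)^-1 *:
    act N (act S (int a (int b (act M u))) - int a (act S (int b (act M u)))).
Proof.
move=> ab wa wb hL hS hM hN.
pose d := imx_diag b (w b); pose w1 r := if r == b then 1 else w r.
have aF : (a == b) = false by rewrite ltn_eqF.
have fd : fixes a d by apply: fixes_diag; rewrite aF.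
have ow r : erase b w1 r = erase b w r by rewrite /erase /w1; case: eqP.
have [n wn] := shears_support hL; pose m := maxn n b.+1.
have bm : (b < m)%N by rewrite leq_max leqnn orbT.
have am : (a < m)%N by rewrite (ltn_trans ab).
have wm r : (m <= r)%N -> w r = 0 by move=> h;
  apply: wn (leq_trans (leq_maxl _ _) h).
have rb r : (m <= r)%N -> (r == b) = false by move=> h;
  rewrite gtn_eqF// (leq_trans bm).
have [L1 hL1] : exists M, shears a w1 M.
  by apply: (@shears_ex _ _ _ m) => // r h; rewrite /w1 rb// wm.
have [S1 hS1] : exists M, shears a (unitv K b) M.
  by apply: (@shears_ex _ _ _ m) => // r h; rewrite /unitv rb.
have [M1 hM1] : exists M, shears b (erase b w1) M.
  by apply: (@shears_ex _ _ _ m) => // r h; rewrite ow /erase rb// wm.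
have [N1 hN1] : exists M, shears b (fun r => - erase b w1 r) M.
  by apply: (@shears_ex _ _ _ m) => // r h; rewrite ow /erase rb// wm// oppr0.
have eL f : act d (act L f) = act L1 (act d f).
  rewrite !hact_comp; congr (act _ f); apply: app_inj => x r.
  rewrite !(app_mul, hL, hL1, app_diag) aF /w1.
  by case: (eqVneq r b) => [->|_]; ring.
have eS f : act d (act S f) = act S1 (act d f).
  rewrite !hact_comp; congr (act _ f); apply: app_inj => x r.
  rewrite !(app_mul, hS, hS1, app_diag) aF /unitv.
  by case: (eqVneq r b) => [->|_]; rewrite /=; ring.
have eM f : act d (act M f) = act M1 (act d f).
  rewrite !hact_comp; congr (act _ f); apply: app_inj => x r.
  rewrite !(app_mul, hM, hM1, app_diag) ow eqxx /erase.
  by case: (eqVneq r b) => [->|_]; field.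
have eN f : act d (act N f) = act N1 (act d f).
  rewrite !hact_comp; congr (act _ f); apply: app_inj => x r.
  rewrite !(app_mul, hN, hN1, app_diag) ow eqxx /erase.
  by case: (eqVneq r b) => [->|_]; field.
have ib f : act d (int b f) = w b *: int b (act d f).
  rewrite (@int_column b b d (w b))//; first last.
  - by move=> r rb'; rewrite -app_unitv app_diag /unitv (negbTE rb') mulr0.
  - by rewrite -app_unitv app_diag /unitv eqxx mulr1.
  rewrite scalerA divff// scale1r [X in _ - X](_ : _ = 0) ?subr0//.
  rewrite hact_comp (_ : (_ * _)%g = imxE K b) ?mask_int//.
  apply: app_inj => x r; rewrite app_mul app_diag !app_E.
  by case: (r == b); rewrite ?mulr0 ?mul1r.
have dinj : injective (act d).
  apply: (can_inj (g := act (imx_diag b (w b)^-1))) => f.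
  rewrite hact_comp -[RHS](hact1 (h:=F)); congr (act _ f).
  apply: app_inj => x r; rewrite app_mul !app_diag app1.
  by case: (r == b); rewrite ?mul1r// mulrA mulfV// mul1r.
apply: dinj; rewrite -(int_act _ fd) eL -(int_act _ fd).
rewrite (@substitution_ruleP _ _ ab w1 _ S1 M1 N1)//; first last.
- by rewrite /w1 eqxx.
- by rewrite /w1 aF.
rewrite hact_scale eN !hact_sub !eS -!(int_act _ fd) !eS ib eM.
by rewrite !(int_scale, hact_scale) -scalerBr scalerA mulVf// scale1r.
Qed.

(** * Integrals with coefficients *)

Lemma slot_free i k u : slot k u -> k != i -> depends u (free_of i).
Proof. by move=> [g g1 ->] ki; apply: at_slot_free. Qed.

Lemma slot_id k u M : slot k u -> (forall x, app M x k = x k) -> act M u = u.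
Proof.
by move=> [g g1 ->] h; apply: (depends_id (at_slot_depends g1)) => r /eqP->.
Qed.

Lemma act_ext1 g M N : g \in hcomp F 1 ->
  (forall x, app M x 0%N = app N x 0%N) -> act M g = act N g.
Proof. by move=> g1 h; apply: (depends_comp g1) => -[|//] _ x. Qed.

(** By the choice of l, the substitution M = L_i(l) M' lets x_j enter only
    through s = (M x)_i, so that [int_column] applies to M'. The coefficient
    has to be written in terms of s: x_j is s / M_ij minus a linear form in the
    other variables, and expanding g at this sum separates the factors without
    x_j, which leave the integral, from a function of s / M_ij. *)
Lemma int_subst_expansion n (M : 'M[K]_n) (i j : 'I_n) g r gamma f :
  g \in hcomp F 1 -> M i j != 0 -> (forall k : 'I_n, (k < i)%N -> M k j = 0) ->
  let l : 'cV_n := \col_k (M k j / M i j) in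
  let a : 'rV_n := \row_k (if k == j then 1 else - (M i k / M i j)) in
  @expansion _ F (index_iota 0 n) (act (imx_of (rowmx a)) g) r gamma ->
  int j (at_slot j g * act (imx_of M) f) = (M i j)^-1 *: \sum_(mu < r)
    let q := act (imx_of (Lmx i (- l) *m M))
       (int i (tau i j (act (imx_diag j (M i j)^-1) (gamma mu j))
               * act (imx_of (Lmx i l)) f)) in
    (\prod_(0 <= k < n | k != j) gamma mu k) * (q - act (imxE K j) q).
Proof.
move=> g1 Mij Mk l a [hs he].
have n0 : (0 < n)%N by apply: leq_ltn_trans (ltn_ord i).
set M' := Lmx i (- l) *m M.
have eM' x s : app (imx_of M') x s
    = app (imx_of M) x s - tail i l s * app (imx_of M) x i.
  by rewrite /M' imx_of_mul app_mul (@Lmx_shears _ _ _ _) tailN mulNr.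
have eM : imx_of M = (imx_of (Lmx i l) * imx_of M')%g.
  apply: app_inj => x s; rewrite app_mul (@Lmx_shears _ _ _ _) !eM'.
  by rewrite (tail_le _ (leqnn i)) mul0r subr0 subrK.
(* The inverse of the substitution x_j |-> x_j - sum_(c != j) (M_ic / M_ij) x_c
   that leads from g(x_j) to the expanded element. *)
pose Sm : 'M[K]_n := \matrix_(s, c) 
  if s == j then M i c / M i j else (s == c)%:R.
have Sj x : app (imx_of Sm) x j = app (imx_of M) x i / M i j.
  rewrite !app_imx_of mulr_suml; apply: eq_bigr => k _.
  by rewrite mxE eqxx mulrAC.
have Sk (k : 'I_n) x : k != j -> app (imx_of Sm) x k = x k.
  move=> kj; rewrite app_imx_of -[RHS](sum_delta x (ltn_ord k)).
  apply: eq_bigr => c _; rewrite mxE (negbTE kj) -val_eqE eq_sym //.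
have eg : at_slot j g = \sum_(mu < r) (\prod_(0 <= k < n | k != j) gamma mu k)
      * act (imx_of Sm) (gamma mu j).
  rewrite (_ : at_slot j g = act (imx_of Sm) (act (imx_of (rowmx a)) g));
    last first.
    rewrite /at_slot hact_comp; apply: act_ext1 => // x.
    rewrite app_mul app_rowmx// app_tperm imx_swapl (bigD1 j)//= mxE eqxx mul1r
      Sj.
    rewrite app_imx_of (bigD1 j)//= mulrDl mulrAC divff// mul1r mulr_suml
      -addrA.
    rewrite -big_split big1 ?addr0//= => k kj.
    by rewrite mxE (negbTE kj) Sk// mulNr mulrAC addrN.
  rewrite he hact_sum; apply: eq_bigr => mu _.
  rewrite hact_prod (bigD1_seq (j : nat)) ?iota_uniq ?mem_index_iota
    ?ltn_ord//= mulrC.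
  congr (_ * _); rewrite big_nat_cond [RHS]big_nat_cond.
  apply: eq_bigr => k /andP[/andP[_ kn] kj].
  apply: slot_id (hs mu k _) _; first by rewrite mem_index_iota.
  by move=> x; rewrite (Sk (Ordinal kn)).
rewrite eg mulr_suml int_sum scaler_sumr; apply: eq_bigr => mu _ /=.
have [g' g'1 eg'] : slot j (gamma mu j).
  by apply: hs; rewrite mem_index_iota ltn_ord.
rewrite -mulrA int_free_mul; last first.
  rewrite big_nat_cond; apply: depends_prod => k /andP[/andP[_ kn] kj].
  by apply: slot_free kj; apply: hs; rewrite mem_index_iota.
rewrite scalerAr; congr (_ * _); rewrite eM -hact_comp.
have -> : act (imx_of Sm) (gamma mu j)
    = act (imx_of M') (tau i j (act (imx_diag j (M i j)^-1) (gamma mu j))).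
  rewrite eg' /at_slot !hact_comp; apply: act_ext1 => // x.
  rewrite !(app_mul, app_tperm, app_diag) imx_swapl eqxx imx_swapr Sj eM'.
  by rewrite (tail_le _ (leqnn i)) mul0r subr0 mulrC.
rewrite -hact_mul (@int_column i j _ (M i j))//.
  by rewrite -app_unitv eM' (tail_le _ (leqnn i)) mul0r subr0 app_unitv imx_ofE.
move=> s si; rewrite -app_unitv eM' !app_unitv imx_ofE.
case: (ltnP s n) => sn; last first.
  by rewrite tail_ge// mul0r subr0 imx_of_in ?sn// gtn_eqF// (leq_trans _ sn).
rewrite (tailE _ (Ordinal sn)) (imx_ofE _ (Ordinal sn)) mxE.
case: (ltngtP s i) => h; last by case/eqP: si.
  by rewrite (Mk (Ordinal sn))// !mul0r subrr.
by rewrite mulr1n divfK// subrr.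
Qed.

Lemma Lmx_at_slot n (i : 'I_n) (w : 'cV[K]_n) g r M :
  g \in hcomp F 1 -> M = imx_of (Lmx i w) ->
  tail i w r = 0 -> act M (at_slot r g) = at_slot r g.
Proof.
move=> g1 -> wr; apply: (depends_id (at_slot_depends g1)) => s /eqP-> x.
by rewrite (@Lmx_shears _ _ _ _) wr mul0r addr0.
Qed.

(** The case of [int_column] that pulls L_i(w) out of an integral along x_j. *)
Lemma Lmx_unit_column n (i : 'I_n) (w : 'cV[K]_n) (j : nat) u : j != i ->
  let L := imx_of (Lmx i w) in
  int j (act L u) = act L (int j u) - act (imxE K j) (act L (int j u)).
Proof.
move=> ji L; rewrite (@int_column j j L 1) ?oner_eq0// ?invr1 ?scale1r//.
  by rewrite -app_unitv (@Lmx_shears _ _ _ _) /unitv eqxx eq_sym (negbTE ji)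
    mulr0 addr0.
move=> r rj; rewrite -app_unitv (@Lmx_shears _ _ _ _) /unitv (negbTE rj).
by rewrite eq_sym (negbTE ji) mulr0 addr0.
Qed.

(** Both sides are double integrals along x_i and x_j, as L_j(w) commutes with
    the integral along x_i. Moving L_i(v') under the integral along x_j on the
    right-hand side replaces x_j by x_j + v_j x_i; expanding h at x_j - v_j x_i
    compensates for this. *)
Lemma int_int_lt n (i j : 'I_n) (v w : 'cV[K]_n) g h r eta f :
  (i < j)%N -> g \in hcomp F 1 -> h \in hcomp F 1 ->
  let v' := Lmx j (- w) *m v in
  @expansion _ F [:: i : nat; j : nat]
    (act (imx_of (rowmx (unit_row K n j - v j 0 *: unit_row K n i))) h) r eta ->
  int j (at_slot j h * act (imx_of (Lmx j w))
      (int i (at_slot i g * act (imx_of (Lmx i v)) f)))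
  = \sum_(mu < r)
      let q := int i (at_slot i g * eta mu i * act (imx_of (Lmx i v'))
                 (int j (eta mu j * act (imx_of (Lmx j w)) f))) in
      q - act (imxE K j) q.
Proof.
move=> ij g1 h1 v' [hs he]; have n0 : (0 < n)%N by apply: leq_ltn_trans
  (ltn_ord i).
have ijF : (i == j :> nat) = false by rewrite ltn_eqF.
have ji : (j : nat) != i by rewrite eq_sym ijF.
set L := imx_of (Lmx j w); set L' := imx_of (Lmx i v').
have tv' s : tail i v' s = tail i v s - tail j w s * v j 0.
  by rewrite tail_Lmx// tailN mulNr.
have eL f' : act L (act (imx_of (Lmx i v)) f') = act L' (act L f').
  rewrite !hact_comp; congr (act _ f'); apply: app_inj => x s.
  rewrite !(app_mul, @Lmx_shears _ _ _ _) !tv' (tailE i j) ij mulr1n (tail_le _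
    (leqnn j)).
  rewrite (tail_le _ (ltnW ij)); ring.
have ei mu : slot i (eta mu i) by apply: hs; rewrite inE eqxx.
have ej mu : slot j (eta mu j) by apply: hs; rewrite !inE eqxx orbT.
have eh : at_slot j h = \sum_(mu < r) eta mu i * act L' (eta mu j).
  rewrite (_ : at_slot j h = act L' (act (imx_of (rowmx
      (unit_row K n j - v j 0 *: unit_row K n i))) h)); last first.
    rewrite /at_slot hact_comp; apply: act_ext1 => // x.
    rewrite app_mul app_rowmx// app_tperm imx_swapl.
    under eq_bigr => k _ do rewrite !mxE mulrBl -mulrA.
    rewrite sumrB -mulr_sumr !(sum_delta _ (ltn_ord _)) !(@Lmx_shears _ _ _ _)
      !tv'.
    rewrite (tailE i j) ij mulr1n (tail_le _ (leqnn i)) (tail_le _ (leqnn j))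
      (tail_le _ (ltnW ij)).
    ring.
  rewrite he hact_sum; apply: eq_bigr => mu _.
  rewrite !big_cons big_nil mulr1 hact_mul; congr (_ * _).
  apply: (slot_id (ei mu)) => x; rewrite (@Lmx_shears _ _ _ _).
  by rewrite (tail_le _ (leqnn i)) mul0r addr0.
have fi : depends (at_slot j h) (free_of i) by apply: at_slot_free.
rewrite -int_act; last first.
  apply: (fixes_shears (@Lmx_shears _ _ _ _)) => //.
  exact: tail_le (ltnW ij).
rewrite -int_free_mul// hact_mul (Lmx_at_slot (r:=i) g1 erefl);
  last exact: tail_le (ltnW ij).
rewrite eL rbint_comm mulrCA eh !mulr_suml !mulr_sumr !int_sum.
apply: eq_bigr => mu _ /=.
have fc : depends (at_slot i g * eta mu i) (free_of j).
  by apply: dependsM; [apply: at_slot_free | apply: slot_free (ei mu) _];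
    rewrite ?ijF.
rewrite -[act (imxE K j) (int i _)]int_act; last by apply: fixes_diag;
  rewrite ijF.
rewrite hact_mul -int_sub (proj1 (free_ofP _ _) fc) -mulrBr; congr (int i _).
rewrite -(Lmx_unit_column _ _ ji) -/L' -int_free_mul//; congr (int j _).
by rewrite hact_mul !mulrA.
Qed.

Lemma shears_free a w i M f : a != i -> shears a w M -> depends f (free_of i) ->
  depends (act M f) (free_of i).
Proof.
move=> ai hM fi; apply: depends_act fi _ => r ri x y h.
by rewrite !hM !h.
Qed.

Lemma mask_free i f : depends (act (imxE K i) f) (free_of i).
Proof.
apply/free_ofP; rewrite hact_comp; congr (act _ f); apply: app_inj => x r.
by rewrite app_mul !app_E; case: eqP.
Qed.

Lemma copy_ex m k :
  exists D, forall x r, app D x r = if r == m then x k else x r.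
Proof.
have fin : exists n, forall r c : nat, (n <= r)%N || (n <= c)%N ->
    1 *+ (c == if r == m then k else r) = (r == c)%:R :> K.
  exists (maxn m k).+1 => r c; rewrite !gtn_max.
  case: (eqVneq r m) => [->|_ _]; last by rewrite eq_sym.
  rewrite ltnn /= => /andP[mc kc].
  by rewrite [c == k]gtn_eqF// [m == c]ltn_eqF.
exists (InfMx fin) => x r; rewrite -[RHS]mul1r -[if _ then _ else _](fun_if x).
exact: app_row1.
Qed.

(** [int_int_shear] has no coefficient between the two integrals. To bring
    h(x_i) under the inner one, take a variable x_N that occurs nowhere else:
    with H = h((x_k - x_N) / w_k), the coefficient h(x_i) is L_i(w)^* H at x_N
    = x_k. As H does not involve x_i, it moves under the inner integral, and
    setting x_N = x_k is postponed to the end. Up to L_i(v'), expanding H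
    separates the functions of x_i, x_k and x_N: they join g(x_i), enter the
    integral along x_k and leave all the integrals, respectively. The term with
    E_k that arises when L_i(v') is pulled out of the integral along x_k is
    killed by the commutator of L_i(wbar)^* with the integral along x_i. *)
Lemma int_int_eq n (i k : 'I_n) (v w : 'cV[K]_n) g h r chi f :
  g \in hcomp F 1 -> h \in hcomp F 1 -> (i < k)%N -> w k 0 != 0 ->
  (forall m : 'I_n, (i < m < k)%N -> w m 0 = 0) ->
  let wbar := w k 0 *: delta_mx k 0 in
  let w' := (w k 0)^-1 *: w in
  let v' := Lmx k (- w') *m v in
  let a := - (v k 0 / w k 0) *: unit_row K n.+1 i
           + (w k 0)^-1 *: unit_row K n.+1 k
           - (w k 0)^-1 *: unit_row K n.+1 n in
  @expansion _ F [:: i : nat; k : nat; n]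
    ((w k 0)^-1 *: act (imx_of (rowmx a)) h) r chi ->
  int i (at_slot i h * act (imx_of (Lmx i w))
      (int i (at_slot i g * act (imx_of (Lmx i v)) f)))
  = \sum_(mu < r) act (imx_of (Lmx k (- w')))
      (tau k n (chi mu n) *
        (let q := int k (chi mu k * act (imx_of (Lmx k w')) f) in
         act (imx_of (Lmx i wbar))
           (int i (at_slot i g * chi mu i * act (imx_of (Lmx i v')) q))
         - int i (at_slot i g * chi mu i * act (imx_of (Lmx i (v' + wbar)))
           q))).
Proof.
move=> g1 h1 ik wk wm wbar w' v' a [hs he].
(* The variable x_n of the expansion may occur in f; x_N does not. *)
have [N nN fN] := hcomp_bound n.+1 f.
have iN : (i < N)%N by apply: leq_trans (ltn_ord i) (ltnW nN).
have kN : (k < N)%N by apply: leq_trans (ltn_ord k) (ltnW nN).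
have ikF : (i == k :> nat) = false by rewrite ltn_eqF.
have kiF : (k == i :> nat) = false by rewrite gtn_eqF.
have iNF : (i == N :> nat) = false by rewrite ltn_eqF.
have kNF : (k == N :> nat) = false by rewrite ltn_eqF.
have tN (s : 'I_n) (z : 'cV[K]_n) : tail s z N = 0 by rewrite tail_ge// ltnW.
have tii (z : 'cV[K]_n) : tail i z i = 0 by apply: tail_le.
have tkk (z : 'cV[K]_n) : tail k z k = 0 by apply: tail_le.
have tki (z : 'cV[K]_n) : tail k z i = 0 by apply: tail_le (ltnW ik).
set Li := imx_of (Lmx i w); set Lv := imx_of (Lmx i v).
set L := imx_of (Lmx k w'); set L' := imx_of (Lmx i v').
set LN := imx_of (Lmx k (- w')); set S := imx_of (Lmx i wbar).
have hLi : shears i (tail i w) Li := Lmx_shears i w.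
have hLv : shears i (tail i v) Lv := Lmx_shears i v.
have hL : shears k (tail k w') L := Lmx_shears k w'.
have hL' : shears i (tail i v') L' := Lmx_shears i v'.
have hLN : shears k (tail k (- w')) LN := Lmx_shears k (- w').
have hS : shears i (tail i wbar) S := Lmx_shears i wbar.
have tw' s : tail k w' s = tail k w s / w k 0 by rewrite tailZ mulrC.
have tv' s : tail i v' s = tail i v s - tail k w' s * v k 0.
  by rewrite tail_Lmx// tailN mulNr.
have twb s : tail i wbar s = w k 0 * unitv K k s by rewrite tailZ tail_delta.
have twk : tail i w k = w k 0 by rewrite tailE ik.
have tvk : tail i v k = v k 0 by rewrite tailE ik.
have ow s : erase k (tail i w) s / w k 0 = tail k w' s.
  rewrite tw' /erase; case: (eqVneq s k) => [->|sk]; first by rewrite tkk.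
  case: (ltnP s n) => sn; last by rewrite !tail_ge.
  rewrite !(tailE _ (Ordinal sn)) /=; case: (ltngtP s k) sk => // ks _.
    rewrite mulr0n; case: (ltnP i s) => is0; last by rewrite mulr0n.
    by rewrite wm ?is0 ?ks// mul0rn.
  by rewrite (ltn_trans ik ks).
have ei mu : slot i (chi mu i) by apply: hs; rewrite inE eqxx.
have ek mu : slot k (chi mu k) by apply: hs; rewrite !inE eqxx orbT.
have en mu : slot n (chi mu n) by apply: hs; rewrite !inE eqxx !orbT.
pose chiN mu := tau n N (chi mu n).
have eN mu : slot N (chiN mu).
  have [c c1 ec] := en mu; exists c => //; rewrite /chiN ec /at_slot hact_comp.
  by apply: act_ext1 => // x; rewrite app_mul !app_tperm !imx_swapl.
(* D sets x_N = x_k. *)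
have [D hD] := copy_ex N k.
have Dchi mu : act D (act LN (chiN mu)) = act LN (tau k n (chi mu n)).
  have [c c1 ec] := en mu; rewrite /chiN ec /at_slot !hact_comp.
  apply: act_ext1 => // x; rewrite !(app_mul, app_tperm, hLN, hD) !imx_swapl
    imx_swapr.
  by rewrite eqxx tN tkk !mul0r.
have Dfree q : depends q (free_of N) -> act D q = q.
  by move=> qN; apply: (depends_id qN) => s /negbTE sN x; rewrite hD sN.
have Dfix : fixes i D.
  split=> [x|x y s si xy]; first by rewrite hD iNF.
  by rewrite !hD; case: eqP => _; apply: xy; rewrite ?kiF.
(* The vector a describes (x_k - v_k x_i - x_n) / w_k; L' cancels the term with
   x_i, since it maps x_k to x_k + v_k x_i. *)
pose H : F := act (imx_of (rowmx a) * (imx_tperm K n N * L'))%g h.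
have rowH M x : app (imx_of (rowmx a) * M)%g x 0%N
    = (app M x k - v k 0 * app M x i - app M x n) / w k 0.
  rewrite app_mul app_rowmx//.
  under eq_bigr => s _ do rewrite !mxE !mulrDl !mulNr -!mulrA.
  rewrite !big_split /= !sumrN -!mulr_sumr.
  rewrite !sum_delta ?ltnSn// ?(leq_trans (ltn_ord _))//; ring.
have eH x : app (imx_of (rowmx a) * (imx_tperm K n N * L'))%g x 0%N
    = (x k - x N) / w k 0.
  rewrite rowH !app_mul !app_tperm imx_swapl !imx_swapD ?iNF ?kNF ?ltn_eqF
    ?ltn_ord//.
  by rewrite !hL' tii tN tv' tkk tvk; ring.
have Hi : depends H (free_of i).
  apply: (depends_act (depends_comp h1)) => -[|//] _ x y xy.
  by rewrite !eH !xy// /free_of 1?eq_sym ?ikF ?iNF.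
have HL : act L H = H.
  rewrite /H hact_comp; apply: act_ext1 => // x; rewrite app_mul.
  have := eH (app L x); rewrite app_mul => ->.
  by rewrite eH !hL tkk tN !mul0r !addr0.
have HD : act D (act Li H) = at_slot i h.
  rewrite /H /at_slot !hact_comp; apply: act_ext1 => // x.
  rewrite app_mul; have := eH (app (Li * D)%g x); rewrite app_mul => ->.
  rewrite !app_mul !hLi !hD eqxx kNF iNF tN twk mul0r addr0 app_tperm imx_swapl.
  by field.
have eL f' : act L (act Lv f') = act L' (act L f').
  rewrite !hact_comp; congr (act _ f'); apply: app_inj => x s.
  rewrite !(app_mul, hLv, hL', hL) !tv' tvk tkk tki; ring.
have He : H = w k 0 *: \sum_(mu < r) act L' (chi mu i * (chi mu k * chiN mu)).
  rewrite -hact_sum -hact_scale.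
  rewrite (_ : _ *: \sum_(mu < r) _ = tau n N (act (imx_of (rowmx a)) h)).
    by rewrite /H -!hact_comp.
  rewrite -[act (imx_of (rowmx a)) h](scalerKV wk) he hact_scale;
    congr (_ *: _).
  rewrite hact_sum; apply: eq_bigr => mu _;
    rewrite !big_cons big_nil mulr1 !hact_mul.
  congr (_ * (_ * _)); symmetry.
    by apply: (slot_id (ei mu)) => x; rewrite app_tperm imx_swapD ?iNF ?ltn_eqF.
  by apply: (slot_id (ek mu)) => x; rewrite app_tperm imx_swapD ?kNF ?ltn_eqF.
have fNf : depends f (free_of N) by apply: free_comp fN.
pose c mu := at_slot i g * chi mu i.
pose X mu := int k (chi mu k * act L f).
pose P mu := act L' (X mu).
have fNc mu : depends (c mu) (free_of N).
  by apply: dependsM; [apply: at_slot_free | apply: slot_free (ei mu) _];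
    rewrite ?iNF.
have fNX mu : depends (X mu) (free_of N).
  apply: depends_int; first by rewrite kNF.
  apply: dependsM; first by apply: slot_free (ek mu) _; rewrite kNF.
  by apply: shears_free hL fNf; rewrite kNF.
have fkc mu : depends (c mu) (free_of k).
  by apply: dependsM; [apply: at_slot_free | apply: slot_free (ei mu) _];
    rewrite ?ikF.
have idc M mu : (forall x, app M x i = x i) -> act M (c mu) = c mu.
  by move=> hM; rewrite hact_mul (slot_id (ei mu))// (slot_id (k := i) (u :=
    at_slot i g))//; exists g.
have S_i x : app S x i = x i by rewrite hS tii mul0r addr0.
have L'_i x : app L' x i = x i by rewrite hL' tii mul0r addr0.
have Y : int k (act L (H * (at_slot i g * act Lv f)))
    = w k 0 *: \sum_(mu < r) chiN mu * (c mu * (P mu - act (imxE K k) (P mu))).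
  rewrite !hact_mul HL (Lmx_at_slot (r:=i) g1 erefl) ?tki// eL mulrCA.
  rewrite int_free_mul; last by apply: at_slot_free => //; rewrite ikF.
  rewrite He -scalerAl int_scale -scalerAr; congr (_ *: _).
  rewrite mulr_suml int_sum mulr_sumr; apply: eq_bigr => mu _.
  rewrite -hact_mul (Lmx_unit_column _ _ (_ : k != i :> nat)) ?kiF// -/L'.
  have -> : chi mu i * (chi mu k * chiN mu) * act L f
      = chi mu i * chiN mu * (chi mu k * act L f) by ring.
  have fk : depends (chi mu i * chiN mu) (free_of k).
    by apply: dependsM; [apply: slot_free (ei mu) _ | apply: slot_free (eN mu)
      _];
      rewrite ?ikF// eq_sym kNF.
  rewrite (int_free_mul _ fk) -/(X mu) hact_mul -/(P mu) [act L' (_ * chiN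
    mu)]hact_mul.
  rewrite (slot_id (ei mu))// (slot_id (eN mu)); last first.
    by move=> x; rewrite hL' tN mul0r addr0.
  rewrite hact_mul (proj1 (free_ofP _ _) fk) -mulrBr /c; ring.
have Nk mu : act S (chiN mu) = chiN mu.
  by apply: (slot_id (eN mu)) => x; rewrite hS tN mul0r addr0.
have fiN mu : depends (chiN mu) (free_of i).
  by apply: slot_free (eN mu) _; rewrite eq_sym iNF.
(* The commutator of S^* with the integral along x_i, applied to c P: the part
   of the summand mu that remains after its E_k-terms cancel. *)
pose B mu := act S (int i (c mu * P mu))
  - int i (c mu * act (imx_of (Lmx i (v' + wbar))) (X mu)).
have SP mu : act S (P mu) = act (imx_of (Lmx i (v' + wbar))) (X mu).
  rewrite hact_comp; congr (act _ _); apply: app_inj => x s.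
  rewrite app_mul hL' !hS (@Lmx_shears _ _ _ _) tailD tii; ring.
have Sfree q : depends q (free_of k) -> act S q = q.
  move=> qk; apply: (depends_id qk) => s /negbTE sk x.
  by rewrite hS twb /unitv sk mulr0 mul0r addr0.
have HB mu : act S (int i (chiN mu * (c mu * (P mu - act (imxE K k) (P mu)))))
    - int i (act S (chiN mu * (c mu * (P mu - act (imxE K k) (P mu)))))
    = chiN mu * B mu.
  have fE := @mask_free k (P mu).
  rewrite [act S (chiN mu * _)]hact_mul Nk [act S (c mu * _)]hact_mul (idc S)//
    hact_sub (Sfree _ fE).
  rewrite !(int_free_mul _ (fiN mu)) hact_mul Nk -mulrBr; congr (_ * _).
  rewrite !mulrBr !int_sub hact_sub SP.
  rewrite [act S (int i (_ * act (imxE K k) _))]Sfree; last first.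
    by apply: depends_int; [rewrite ikF | apply: dependsM].
  by rewrite /B; ring.
have fNB mu : depends (B mu) (free_of N).
  have iN' : i != N :> nat by rewrite iNF.
  apply: dependsB.
    apply: shears_free hS _ => //; apply: depends_int => //;
      apply: dependsM => //.
    exact: shears_free hL' _.
  apply: depends_int => //; apply: dependsM => //.
  exact: shears_free (Lmx_shears _ _) _.
have fNLi : depends (act Li (int i (at_slot i g * act Lv f))) (free_of N).
  have iN' : i != N :> nat by rewrite iNF.
  apply: shears_free hLi _ => //; apply: depends_int => //; apply: dependsM.
    exact: at_slot_free.
  exact: shears_free hLv _.
rewrite -HD -(Dfree _ fNLi) -!hact_mul (int_act _ Dfix) -(int_free_mul _ Hi).
rewrite (@int_int_shear i k (tail i w) Li S L LN)//; first last.
- by apply: shears_ext hLN => s; rewrite tailN twk ow.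
- by apply: shears_ext hL => s; rewrite twk ow.
- by apply: shears_ext hS => s; rewrite twb twk.
- by rewrite twk.
rewrite Y twk !(hact_scale, int_scale) -scalerBr !hact_scale scalerK//.
rewrite !(hact_sum, int_sum) -sumrB !hact_sum; apply: eq_bigr => mu _.
rewrite HB !hact_mul Dchi Dfree//.
by apply: shears_free hLN _; rewrite ?kNF.
Qed.
End Integrals.

(** * Evaluation of terms as operators *)

Section Action.
Variables (K : fieldType) (F G : rb_hierarchy K) (j : {lrmorphism G -> F}).
Hypothesis sub : rb_subhierarchy j.
Local Notation term := (pterm K (pio_gen G)).

Fixpoint ev (t : term) (f : F) : F :=
  match t with
  | PConst c => c *: f
  | PVar (GCoef g) => j g * f
  | PVar (GSubst M) => hact F M f
  | PVar (GInt i) => rbint F i f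
  | PAdd s t => ev s f + ev t f
  | PMul s t => ev s (ev t f)
  end.

Lemma ev_linear t : linear (ev t).
Proof.
elim: t => [c|[g|M|i]|s IHs t IHt|s IHs t IHt] a f g' /=.
- by rewrite scalerDr !scalerA mulrC.
- by rewrite mulrDr scalerAr.
- exact: linearP.
- exact: linearP.
- by rewrite IHs IHt scalerDr addrACA.
- by rewrite IHt IHs.
Qed.

Lemma evD t f g : ev t (f + g) = ev t f + ev t g.
Proof. by have := ev_linear t 1 f g; rewrite !scale1r. Qed.

Lemma evZ t c f : ev t (c *: f) = c *: ev t f.
Proof.
have e0 : ev t 0 = 0.
  by have := ev_linear t (-1) 0 0; rewrite scaleN1r oppr0 addr0 scaleN1r addNr.
by have := ev_linear t c f 0; rewrite e0 !addr0.
Qed.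

Lemma ev_sum n (t : 'I_n -> term) f :
  ev (\big[@PAdd _ _/PConst _ 0]_(i < n) t i) f = \sum_(i < n) ev (t i) f.
Proof.
by apply: (big_morph (fun t => ev t f)) => //=; rewrite scale0r.
Qed.

Lemma j_comp n g : g \in hcomp G n -> j g \in hcomp F n.
Proof. exact: (rbsub_comp sub). Qed.

Lemma j_slot i g : j (at_slot i g) = at_slot i (j g).
Proof. exact: (rbsub_act sub). Qed.

Lemma j_expansion s g r c : @expansion K G s g r c ->
  @expansion K F s (j g) r (fun mu k => j (c mu k)).
Proof.
move=> [hs he]; split=> [mu k /(hs mu)[g' g'1 ->]|].
  by exists (j g'); rewrite ?j_slot ?j_comp.
by rewrite he rmorph_sum; apply: eq_bigr => mu _; rewrite rmorph_prod.
Qed.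

(** The homomorphism j carries expansions in G to expansions in F, so each
    relation follows from the corresponding identity between integrals in F. *)
Lemma ev_rel s t : pio_rel s t -> ev s =1 ev t.
Proof.
have jM g h : j (g * h) = j g * j h by exact: rmorphM.
have jZ a g : j (a *: g) = a *: j g by exact: linearZ.
have jE := (j_slot, rbsub_act sub, rbsub_int sub, jM, jZ).
case=> {s t} /=.
- by move=> g h f; rewrite rmorphD mulrDl.
- by move=> g h f; rewrite rmorphM mulrA.
- by move=> c f; rewrite linearZ /= rmorph1 -scalerAl mul1r.
- by move=> f; rewrite hact1 scale1r.
- by move=> M N f; rewrite hactM.
- by move=> i k f; rewrite rbint_comm.
- by move=> M g f; rewrite hact_mul jE.
- move=> M i Mi f; rewrite scale0r.
  rewrite (_ : M = (imxE K i * M)%g) -?hact_comp ?mask_int ?rmorph0//.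
  apply: app_inj => x r; rewrite app_mul app_E; case: eqP => // ->.
  by rewrite (@app_row1 _ _ _ _ 0 0) ?mul0r// => c; rewrite mul0rn.
- move=> i k g ik g1 f; rewrite jE int_free_mul//.
  by apply: at_slot_free (j_comp g1); rewrite ltn_eqF.
- move=> i k g ik g1 f; rewrite jE int_free_mul//.
  by apply: at_slot_free (j_comp g1); rewrite gtn_eqF.
- move=> n M i k g r gamma g1 Mik Mk /j_expansion; rewrite jE => hex f.
  rewrite jE (int_subst_expansion _ (j_comp g1) Mik Mk hex) ev_sum;
    congr (_ *: _).
  by apply: eq_bigr => mu _ /=; rewrite !jE rmorph_prod scale1r scaleN1r.
- move=> M k g _ Mk f; rewrite !jE [at_slot k (j g) * _]mulrC.
  rewrite int_free_mul; first exact: mulrC.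
  apply/free_ofP; rewrite hact_comp; congr (hact F _ f); apply: app_inj => x r.
  by rewrite app_mul app_mask Mk mul0r subr0.
- move=> n i k v w g h r eta ik g1 h1 /j_expansion; rewrite jE => hex f.
  rewrite !jE (int_int_lt w f ik (j_comp g1) (j_comp h1) hex) ev_sum.
  by apply: eq_bigr => mu _ /=; rewrite !jE scale1r scaleN1r.
- move=> n i k v w g h r chi g1 h1 ik wk wm /j_expansion.
  rewrite !jE => hex f.
  rewrite (int_int_eq f (j_comp g1) (j_comp h1) ik wk wm hex) ev_sum.
  by apply: eq_bigr => mu _ /=; rewrite !jE scaleN1r.
- move=> k g _ f; rewrite !jE scaleN1r.
  by rewrite (rbint_rb k (at_slot k (j g)) f) addrK.
Qed.

Lemma ev_cong s t : pcong (@pio_rel K G) s t -> ev s =1 ev t.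
Proof.
elim=> {s t} /=.
- exact: ev_rel.
- by [].
- by move=> s t _ IH f; rewrite IH.
- by move=> s t u _ st _ tu f; rewrite st tu.
- by move=> s s' t t' _ st _ tu f; rewrite st tu.
- by move=> s s' t t' _ st _ tu f; rewrite tu st.
- by move=> s t u f; rewrite addrA.
- by move=> s t f; rewrite addrC.
- by move=> t f; rewrite scale0r add0r.
- by move=> t f; rewrite scaleN1r addNr scale0r.
- by [].
- by move=> t f; rewrite scale1r.
- by move=> t f; rewrite scale1r.
- by [].
- by move=> s t u f; rewrite evD.
- by move=> a b f; rewrite scalerDl.
- by move=> a b f; rewrite scalerA.
- by move=> a t f; rewrite evZ.
Qed.

Definition odot_fun (a : pio G) : F -> F := ev (repr a).
HB.instance Definition _ (a : pio G) :=
  GRing.isLinear.Build K F F _ (odot_fun a) (ev_linear (repr a)).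
Definition odot (a : pio G) : {linear F -> F} := odot_fun a.

Lemma odot_class t f : odot (pclass (@pio_rel K G) t) f = ev t f.
Proof. by apply: ev_cong; apply: pcong_repr. Qed.
End Action.

Theorem proposition4p9 (K : fieldType) (charK : [pchar K] =i pred0)
    (F G : rb_hierarchy K) (j : {lrmorphism G -> F})
    (admG : admissible_domain j) :
  exists odot : pio G -> {linear F -> F},
    [/\ pio_action odot,
        forall g f, odot (pio_coef g) f = j g * f,
        forall M f, odot (pio_subst G M) f = hact F M f
      & forall i f, odot (pio_int G i) f = rbint F i f].
Proof.
have sub := proj1 admG; exists (odot j); split; do ?by move=> *;
  rewrite odot_class.
split=> [a b f|c a f|f|a b f].
- by rewrite [LHS](odot_class sub).
- by rewrite [LHS](odot_class sub).
- by rewrite [LHS](odot_class sub) /= scale1r.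
- by rewrite [LHS](odot_class sub).
Qed.
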